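(* Let $\Omega\subset\mathbb{R}^2$ be a bounded domain and let $u,v\in C^{2}(\Omega)\cap C^{0}(\bar\Omega)$. For $w\in\{u,v\}$ let $S(w)=\{(x,y)\in\Omega: w_x-y=0,\ w_y+x=0\}$ and on $\Omega\setminus S(w)$ let $N(w)=(w_x-y,\,w_y+x)/\sqrt{(w_x-y)^2+(w_y+x)^2}$. Let $S=S(u)\cup S(v)$. Suppose $\operatorname{div}N(u)\ge\operatorname{div}N(v)$ in $\Omega\setminus S$, $u\le v$ on $\partial\Omega$, and $\mathcal{H}_1(\bar S)=0$, where $\mathcal{H}_1$ is the 1-dimensional Hausdorff measure. Then $u\le v$ in $\Omega$.
   Context: $\operatorname{div}$ denotes the Euclidean divergence in the $xy$-plane. *)

(* Defs.v *)
From HB Require Import structures.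
From mathcomp Require Import all_boot all_order all_algebra.
From mathcomp Require Import all_classical all_reals all_analysis.
Set Implicit Arguments. Unset Strict Implicit. Unset Printing Implicit Defensive.
Import Order.TTheory GRing.Theory Num.Theory.
Import numFieldNormedType.Exports.
Local Open Scope classical_set_scope.
Local Open Scope ring_scope.

Section Defs.
Variable R : realType.
Notation P := (R * R)%type.

Definition e1 : P := (1, 0).
Definition e2 : P := (0, 1).

Definition px (w : P -> R) : P -> R := fun p => 'D_e1 w p.
Definition py (w : P -> R) : P -> R := fun p => 'D_e2 w p.

Definition C1_on (O : set P) (w : P -> R) : Prop :=
  forall p, O p ->
    [/\ derivable w p e1, derivable w p e2,
        {for p, continuous (px w)} & {for p, continuous (py w)}].

Definition C2_on (O : set P) (w : P -> R) : Prop :=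
  [/\ C1_on O w, C1_on O (px w) & C1_on O (py w)].

Definition Sing (O : set P) (w : P -> R) : set P :=
  [set p | O p /\ px w p - p.2 = 0 /\ py w p + p.1 = 0].

Definition Nden (w : P -> R) (p : P) : R :=
  Num.sqrt ((px w p - p.2) ^+ 2 + (py w p + p.1) ^+ 2).
Definition N1 (w : P -> R) : P -> R := fun p => (px w p - p.2) / Nden w p.
Definition N2 (w : P -> R) : P -> R := fun p => (py w p + p.1) / Nden w p.

Definition divN (w : P -> R) (p : P) : R := px (N1 w) p + py (N2 w) p.

(* Euclidean distance and diameter (in \bar R, with diam set0 = 0) *)
Definition edist (p q : P) : R := Num.sqrt ((p.1 - q.1) ^+ 2 + (p.2 - q.2) ^+ 2).
Definition ediam (C : set P) : \bar R :=
  ereal_sup ([set 0%E] `|` [set (edist p q)%:E | p in C & q in C]).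

Definition H1_delta (d : R) (A : set P) : \bar R :=
  ereal_inf [set (\sum_(0 <= i <oo) ediam (C i))%E |
             C in [set C : nat -> set P |
                   A `<=` \bigcup_i C i /\ forall i, (ediam (C i) <= d%:E)%E]].
Definition H1 (A : set P) : \bar R :=
  ereal_sup [set H1_delta d A | d in [set d : R | 0 < d]].

End Defs.

(* Main.v *)
Require Import Defs.
From HB Require Import structures.
From mathcomp Require Import all_boot all_order all_algebra.
From mathcomp Require Import all_classical all_reals all_analysis.
From mathcomp Require Import ring lra.
Import Order.TTheory GRing.Theory Num.Theory.
Import numFieldNormedType.Exports.
Local Open Scope classical_set_scope.
Local Open Scope ring_scope.

(* Put w = u - v, alpha = grad u + (-y, x), beta = grad v + (-y, x), so that
   grad w = alpha - beta. The pairing grad w . (N(u) - N(v)) equals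
   (|alpha| + |beta|) (1 - N(u) . N(v)), hence is nonnegative and vanishes only where
   alpha and beta are parallel. Testing div N(u) >= div N(v) against a function of
   (w - eps)^+ cut off near the singular set shows that its integral over {w > eps} is
   zero: the cutoff costs nothing in the limit because N is bounded and the singular
   set is H1-null. So dw is parallel to the contact form theta = du + x dy - y dx on
   {w > 0}; there d(g(w) theta) = 2 g(w) dx dy for every g, and if g(w) has compact
   support its integral is zero, which forces {w > 0} to be empty. *)

Set Implicit Arguments. Unset Strict Implicit. Unset Printing Implicit Defensive.

(** * Integration over a square *)

Section PlaneIntegral.
Variable R : realType.
Local Notation P := (R * R)%type.
Implicit Types (f g h X : P -> R) (p q : P).

Local Notation leb := (@lebesgue_measure R).
Local Notation leb2 := (leb \x leb)%E.

(** Two obstacles shape the proof: [u] and [v] are merely continuous up to an arbitrary boundary,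
    and the unit fields break down on the singular set, so neither set can serve as the edge of a
    region of integration. Every integration by parts is therefore made for a C1 field on the whole
    plane, the extension by zero of a field on an open set; Fubini and the one-dimensional
    fundamental theorem then suffice. Squared positive parts keep the test functions C1. The
    threshold eps > 0 makes {w >= eps} a closed subset of the plane inside the domain, because w <=
    0 on the boundary. A cutoff around a square of half-side r has gradient of order 1/r on an area
    of order r^2, hence costs order r, which is exactly the scaling that H1 measures; compactness of
    the closed singular set makes the cover finite, so that summing the cutoffs is harmless. The
    second integration needs no cutoff, since theta, unlike the unit fields, is C1 across the
    singular set. *)

Lemma nbhs_square (U : set P) p : nbhs p U ->
  exists2 r : R, 0 < r &
    forall q, `|q.1 - p.1| < r -> `|q.2 - p.2| < r -> U q.
Proof.
move=> /nbhs_ballP[r /= r0 rU]; exists r => // q q1 q2; apply: rU.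
by split; rewrite /ball /= distrC.
Qed.

(** The product sigma-algebra contains rectangles, and an open set is the countable union of the
    rational open rectangles inside it; [Q] replaces the other rectangles by the empty set. *)
Lemma open_measurable_plane (U : set P) : open U ->
  measurable (U : set (measurableTypeR R * measurableTypeR R)).
Proof.
move=> oU.
pose I (a b : rat) : set R := `]ratr a, ratr b[%classic.
pose Q (a b c d : rat) : set P := if `[< I a b `*` I c d `<=` U >]
  then I a b `*` I c d else set0.
have -> : U = \bigcup_a \bigcup_b \bigcup_c \bigcup_d Q a b c d.
  apply/seteqP; split=> [p Up|p [a _] [b _] [c _] [d _]]; last first.
    by rewrite /Q; case: asboolP => // s; exact: s.
  have [r r0 rU] := nbhs_square (open_nbhs_nbhs (conj oU Up)).
  have rat_between (x : R) : exists a b : rat, [/\ x - r < ratr a, ratr a < x,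
      x < ratr b & ratr b < x + r].
    have [a] := @rat_in_itvoo R (x - r) x ltac:(lra).
    have [b] := @rat_in_itvoo R x (x + r) ltac:(lra).
    rewrite !in_itv /= => /andP[? ?] /andP[? ?]; by exists a, b.
  have [a [b [a1 a2 b1 b2]]] := rat_between p.1.
  have [c [d [c1 c2 d1 d2]]] := rat_between p.2.
  exists a => //; exists b => //; exists c => //; exists d => //.
  rewrite /Q; case: asboolP => [_|[]].
    by split; rewrite /I /= in_itv /=; apply/andP.
  move=> q [] /=; rewrite /I /= !in_itv /= => /andP[? ?] /andP[? ?].
  by apply: rU; rewrite ltr_norml; apply/andP; split; lra.
do 4! (apply: bigcupT_measurable_rat => ?).
rewrite /Q; case: asboolP => // _.
by apply: measurableX; exact: measurable_itv.
Qed.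

Lemma continuous_measurable_plane f : continuous f ->
  measurable_fun setT (f : (measurableTypeR R * measurableTypeR R) -> R).
Proof.
move=> /continuousP cf.
apply: (measurability _ (measurable_realfun.RGenOpens.measurableE R)).
move=> _ [_ [a [b ->] <-]]; rewrite setTI; apply: open_measurable_plane.
exact/cf/interval_open.
Qed.

Definition square (c : P) (r : R) : set P :=
  `[c.1 - r, c.1 + r]%classic `*` `[c.2 - r, c.2 + r]%classic.

Lemma squareP c r q : square c r q <-> `|q.1 - c.1| <= r /\ `|q.2 - c.2| <= r.
Proof.
rewrite /square /= !in_itv /= !ler_norml.
by split=> -[/andP[? ?] /andP[? ?]]; split; apply/andP; split; lra.
Qed.

Lemma measurable_square c r :
  measurable (square c r : set (measurableTypeR R * measurableTypeR R)).
Proof. by apply: measurableX; exact: measurable_itv. Qed.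

Lemma leb2_square c r : 0 < r -> leb2 (square c r) = ((2 * r) ^+ 2)%:E.
Proof.
move=> r0.
have L (a : R) : leb `[a - r, a + r]%classic = (2 * r)%:E.
  rewrite lebesgue_measure_itv /= lte_fin ifT; last by lra.
  by rewrite -EFinB; congr EFin; ring.
rewrite /square [LHS]product_measure1E; try exact: measurable_itv.
by rewrite [X in (X * _)%E]L [X in (_ * X)%E]L -EFinM expr2.
Qed.

Lemma compact_square c r : compact (square c r).
Proof. by apply: compact_setX; exact: segment_compact. Qed.

Lemma integrable_square f c r : 0 < r -> continuous f ->
  leb2.-integrable (square c r) (EFin \o f).
Proof.
move=> r0 cf; apply: measurable_bounded_integrable.
- exact: measurable_square.
- by rewrite [X in (X < _)%E](leb2_square c r0) ltry.
- apply: measurable_funTS; exact: continuous_measurable_plane.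
- have cfS : {within square c r, continuous f} by exact: continuous_subspaceT.
  have /compact_bounded[M [_ mrt]] := continuous_compact cfS (@compact_square c r).
  by exists M; split; rewrite ?num_real // => ? ? ? ?; exact: mrt.
Qed.

Lemma is_derive_e1 f p d : is_derive p (e1 R) f d ->
  is_derive (p.1 : R) 1 (fun x => f (x, p.2)) d.
Proof.
have E : (fun h : R => h^-1 *:
     (((fun x => f (x, p.2)) \o shift p.1) (h *: 1) - f (p.1, p.2)))
   = (fun h : R => h^-1 *: ((f \o shift p) (h *: e1 R) - f p)).
  apply/funext => h /=; rewrite /shift /= -!surjective_pairing.
  by congr (h^-1 *: (f _ - f p)); apply: injective_projections;
    rewrite /= ?scaler0 ?add0r.
move=> [df dfE]; split.
  by rewrite /derivable E.
by rewrite -dfE /derive E.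
Qed.

Lemma is_derive_e2 f p d : is_derive p (e2 R) f d ->
  is_derive (p.2 : R) 1 (fun y => f (p.1, y)) d.
Proof.
have E : (fun h : R => h^-1 *:
     (((fun y => f (p.1, y)) \o shift p.2) (h *: 1) - f (p.1, p.2)))
   = (fun h : R => h^-1 *: ((f \o shift p) (h *: e2 R) - f p)).
  apply/funext => h /=; rewrite /shift /= -!surjective_pairing.
  by congr (h^-1 *: (f _ - f p)); apply: injective_projections;
    rewrite /= ?scaler0 ?add0r.
move=> [df dfE]; split.
  by rewrite /derivable E.
by rewrite -dfE /derive E.
Qed.

Lemma FTC2_vanish (F F' : R -> R) (a b : R) : a < b ->
  (forall x : R, is_derive x 1 F (F' x)) -> continuous F' -> F a = F b ->
  (\int[leb]_(x in `[a, b]) (F' x)%:E = 0)%E.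
Proof.
move=> ab dF cF' Fab.
have cF : continuous F.
  by move=> x; apply/differentiable_continuous/derivable1_diffP; have [] := dF x.
rewrite (@continuous_FTC2 R F' F) //.
- by rewrite Fab subee.
- exact: continuous_subspaceT.
- split.
  + by move=> x _; have [] := dF x.
  + by apply: cvg_at_right_filter; exact: cF.
  + by apply: cvg_at_left_filter; exact: cF.
- by move=> x _; have [_ dv] := dF x; rewrite derive1E.
Qed.

Lemma continuous_pairl (y : R) : continuous (fun x : R => (x, y)).
Proof.
move=> x U [[A B] [/= nA nB] sAB]; apply: filterS nA => z Az.
by apply: (sAB (z, y)); split=> //; exact: nbhs_singleton.
Qed.

Lemma continuous_pairr (x : R) : continuous (fun y : R => (x, y)).
Proof.
move=> y U [[A B] [/= nA nB] sAB]; apply: filterS nB => z Bz.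
by apply: (sAB (x, z)); split=> //; exact: nbhs_singleton.
Qed.

Definition box (B : R) := square (0, 0) B.

Definition Ibox (B : R) f : R := (\int[leb2]_(p in box B) f p)%R.

(** On each horizontal line the fundamental theorem leaves the difference of two zero boundary
    values; Fubini does the rest. With [Ibox_dy], this is the only form of the divergence theorem
    that is used. *)
Lemma Ibox_dx B X X' : 0 < B -> (forall p, is_derive p (e1 R) X (X' p)) ->
  continuous X' -> (forall p, `|p.1| = B -> X p = 0) -> Ibox B X' = 0.
Proof.
move=> B0 dX cX' X0; rewrite /Ibox /Rintegral.
have iX : leb2.-integrable setT ((EFin \o X') \_ (box B)).
  apply: (iffLR (integrable_mkcond _ (@measurable_square (0, 0) B))).
  exact: integrable_square.
rewrite integral_mkcond -(integral21_prod_meas1 iX) /fubini_G.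
rewrite integral0_eq // => y _.
have [yB|yB] := boolP (y \in `[- B, B]%classic); last first.
  rewrite integral0_eq // => x _; rewrite patchE ifF //.
  apply/negP; rewrite inE /box /square /= => -[_].
  by rewrite sub0r add0r; move: yB; rewrite notin_setE.
transitivity (\int[leb]_(x in `[(- B)%R, B]) (X' (x, y))%:E)%E.
  rewrite [RHS]integral_mkcond; apply: eq_integral => x _.
  rewrite !patchE; congr (if _ then _ else _).
  rewrite /box /square sub0r add0r in_setX /=.
  by rewrite [X in _ && X]yB andbT.
apply: (@FTC2_vanish (fun x => X (x, y)) (fun x => X' (x, y))) => /=.
- by lra.
- by move=> x; exact: (is_derive_e1 (dX (x, y))).
- move=> x; apply: (@continuous_comp _ _ _ (fun x : R => (x, y)) X'); last exact: cX'.
  exact: continuous_pairl.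
- by rewrite !X0 //= ?normrN gtr0_norm.
Qed.

Lemma Ibox_dy B X X' : 0 < B -> (forall p, is_derive p (e2 R) X (X' p)) ->
  continuous X' -> (forall p, `|p.2| = B -> X p = 0) -> Ibox B X' = 0.
Proof.
move=> B0 dX cX' X0; rewrite /Ibox /Rintegral.
have iX : leb2.-integrable setT ((EFin \o X') \_ (box B)).
  apply: (iffLR (integrable_mkcond _ (@measurable_square (0, 0) B))).
  exact: integrable_square.
rewrite integral_mkcond -(integral12_prod_meas1 iX) /fubini_F.
rewrite integral0_eq // => x _.
have [xB|xB] := boolP (x \in `[- B, B]%classic); last first.
  rewrite integral0_eq // => y _; rewrite patchE ifF //.
  apply/negP; rewrite inE /box /square /= => -[+ _].
  by rewrite sub0r add0r; move: xB; rewrite notin_setE.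
transitivity (\int[leb]_(y in `[(- B)%R, B]) (X' (x, y))%:E)%E.
  rewrite [RHS]integral_mkcond; apply: eq_integral => y _.
  rewrite !patchE; congr (if _ then _ else _).
  rewrite /box /square sub0r add0r in_setX /=.
  by rewrite [X in X && _]xB.
apply: (@FTC2_vanish (fun y => X (x, y)) (fun y => X' (x, y))) => /=.
- by lra.
- by move=> y; exact: (is_derive_e2 (dX (x, y))).
- move=> y; apply: (@continuous_comp _ _ _ (fun y : R => (x, y)) X'); last exact: cX'.
  exact: continuous_pairr.
- by rewrite !X0 //= ?normrN gtr0_norm.
Qed.

Lemma IboxD B f g : 0 < B -> continuous f -> continuous g ->
  Ibox B (fun p => f p + g p) = Ibox B f + Ibox B g.
Proof.
move=> B0 cf cg; apply: RintegralD; first exact: (@measurable_square (0, 0) B).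
- exact: integrable_square.
- exact: integrable_square.
Qed.

Lemma IboxZ B k f : 0 < B -> continuous f ->
  Ibox B (fun p => k * f p) = k * Ibox B f.
Proof.
move=> B0 cf; apply: RintegralZl; first exact: (@measurable_square (0, 0) B).
exact: integrable_square.
Qed.

Lemma le_Ibox B f g : 0 < B -> continuous f -> continuous g ->
  (forall p, f p <= g p) -> Ibox B f <= Ibox B g.
Proof.
move=> B0 cf cg fg; apply: le_Rintegral => //; first exact: (@measurable_square (0, 0) B).
- exact: integrable_square.
- exact: integrable_square.
Qed.

Lemma Ibox_square_le B f c r M : 0 < r -> 0 < B -> continuous f -> 0 <= M ->
  (forall p, 0 <= f p <= M) -> (forall p, ~ square c r p -> f p = 0) ->
  Ibox B f <= M * (2 * r) ^+ 2.
Proof.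
move=> r0 B0 cf M0 fM f0.
have mS := @measurable_square c r.
have mB := @measurable_square (0, 0) B.
have iS := integrable_square (0, 0) B0 cf.
have iC := integrable_square c r0 (@cst_continuous _ _ M).
rewrite -lee_fin /Ibox /Rintegral fineK; last exact: integrable_fin_num.
have -> : (M * (2 * r) ^+ 2)%:E = (\int[leb2]_(p in square c r) (cst M%:E p))%E.
  by rewrite integral_cst //= [X in (_ * X)%E](leb2_square c r0).
rewrite [leLHS]integral_mkcond [leRHS]integral_mkcond.
apply: ge0_le_integral => //.
- by move=> p _; rewrite patchE; case: ifP => // _; rewrite lee_fin; case/andP: (fM p).
- exact: measurable_int (iffLR (integrable_mkcond _ mB) iS).
- exact: measurable_int (iffLR (integrable_mkcond _ mS) iC).
- move=> p _; rewrite !patchE; have /andP[fp0 fpM] := fM p.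
  case: (boolP (p \in square c r)) => [_|]; first by case: ifP; rewrite lee_fin.
  by rewrite notin_setE => /f0 fp; case: ifP => //=; rewrite fp.
Qed.

Lemma Ibox_square_ge B f c r m : 0 < r -> 0 < B -> continuous f -> 0 <= m ->
  (forall p, 0 <= f p) -> (forall p, square c r p -> m <= f p) ->
  square c r `<=` box B ->
  m * (2 * r) ^+ 2 <= Ibox B f.
Proof.
move=> r0 B0 cf m0 f0 fm sB.
have mS := @measurable_square c r.
have mB := @measurable_square (0, 0) B.
have iS := integrable_square (0, 0) B0 cf.
have iC := integrable_square c r0 (@cst_continuous _ _ m).
rewrite -lee_fin /Ibox /Rintegral fineK; last exact: integrable_fin_num.
have -> : (m * (2 * r) ^+ 2)%:E = (\int[leb2]_(p in square c r) (cst m%:E p))%E.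
  by rewrite integral_cst //= [X in (_ * X)%E](leb2_square c r0).
rewrite [leLHS]integral_mkcond [leRHS]integral_mkcond.
apply: ge0_le_integral => //.
- by move=> p _; rewrite patchE; case: ifP => // _; rewrite lee_fin.
- exact: measurable_int (iffLR (integrable_mkcond _ mS) iC).
- exact: measurable_int (iffLR (integrable_mkcond _ mB) iS).
- move=> p _; rewrite !patchE.
  case: (boolP (p \in square c r)) => [|_]; last by case: ifP; rewrite // lee_fin.
  by rewrite inE => pS; rewrite ifT ?lee_fin; [exact: fm|rewrite inE; exact: sB].
Qed.

Lemma Ibox_gt0 B f p : 0 < B -> continuous f -> (forall q, 0 <= f q) ->
  `|p.1| < B -> `|p.2| < B -> 0 < f p -> 0 < Ibox B f.
Proof.
move=> B0 cf f0 p1 p2 fp.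
have nf : \forall q \near p, f p / 2 < f q.
  by apply: (cvgr_gt _ (cf p)); lra.
have c1 : {for p, continuous (fun q : P => `|q.1|)} by apply: cvg_norm; exact: cvg_fst.
have c2 : {for p, continuous (fun q : P => `|q.2|)} by apply: cvg_norm; exact: cvg_snd.
have nB : \forall q \near p, `|q.1| < B /\ `|q.2| < B.
  by apply: filterI; [exact: (cvgr_lt _ c1 _ p1)|exact: (cvgr_lt _ c2 _ p2)].
have [r r0 rP] := nbhs_square (filterI nB nf).
(* The radius is halved because the neighbourhood contains an open square while [square] is
   closed. *)
have r2 : 0 < r / 2 by lra.
have sP q : square p (r / 2) q -> (`|q.1| < B /\ `|q.2| < B) /\ f p / 2 < f q.
  by move=> /squareP[? ?]; apply: rP; lra.
apply: lt_le_trans (@Ibox_square_ge B f p (r / 2) (f p / 2) r2 B0 cf _ f0 _ _).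
- by rewrite mulr_gt0 ?exprn_gt0 //; lra.
- by lra.
- by move=> q /sP[_ /ltW].
- move=> q /sP[[q1 q2] _]; apply/squareP; rewrite !subr0.
  by split; exact: ltW.
Qed.

End PlaneIntegral.

(** * Directional derivatives *)

Section DirectionalC1.
Variable R : realType.
Local Notation P := (R * R)%type.
Implicit Types (O K : set P) (e p q : P) (f g : P -> R).

Lemma is_derive_slice f e p (t d : R) : is_derive (t *: e + p) e f d ->
  is_derive t (1 : R) (fun s : R => f (s *: e + p)) d.
Proof.
have E : (fun h : R => h^-1 *:
     (((fun s : R => f (s *: e + p)) \o shift t) (h *: 1) - f (t *: e + p)))
   = (fun h : R => h^-1 *: ((f \o shift (t *: e + p)) (h *: e) - f (t *: e + p))).
  apply/funext => h /=; rewrite /shift /=.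
  by congr (h^-1 *: (f _ - _)); rewrite [_%:A]mulr1 scalerDl addrA.
move=> [df dfE]; split.
  by rewrite /derivable E.
by rewrite -dfE /derive E.
Qed.

Lemma is_derive_unslice f e p (d : R) :
  is_derive (0 : R) (1 : R) (fun s : R => f (s *: e + p)) d -> is_derive p e f d.
Proof.
have E : (fun h : R => h^-1 *:
     (((fun s : R => f (s *: e + p)) \o shift 0) (h *: 1) - f (0 *: e + p)))
   = (fun h : R => h^-1 *: ((f \o shift p) (h *: e) - f p)).
  apply/funext => h /=; rewrite /shift /=.
  by congr (h^-1 *: (f _ - f _)); rewrite ?[_%:A]mulr1 ?addr0 // scale0r add0r.
move=> [df dfE]; split.
  by move: df; rewrite /derivable E.
by rewrite -dfE /derive E.
Qed.

Lemma is_derive_comp1 f e p (d : R) (g : R -> R) (g' : R) :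
  is_derive p e f d -> is_derive (f p) (1 : R) g g' ->
  is_derive p e (g \o f) (g' * d).
Proof.
move=> df dg; apply: is_derive_unslice.
apply: (@is_derive1_comp R g (fun s => f (s *: e + p))).
  by rewrite scale0r add0r.
by apply: is_derive_slice; rewrite scale0r add0r.
Qed.

(** Continuity of [f] is part of the notion, as a derivative along a single direction does not imply
    it. The derivative [f'] is carried explicitly so that sums, products and compositions produce
    formulas. *)
Definition C1dir e O f f' := forall p, O p ->
  [/\ {for p, continuous f}, is_derive p e f (f' p) & {for p, continuous f'}].

Lemma C1dirS e O O' f f' : O' `<=` O -> C1dir e O f f' -> C1dir e O' f f'.
Proof. by move=> sO cf p /sO /cf. Qed.

Lemma C1dirD e O f f' g g' : C1dir e O f f' -> C1dir e O g g' ->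
  C1dir e O (fun p => f p + g p) (fun p => f' p + g' p).
Proof.
move=> cf cg p Op; have [f0 f1 f2] := cf p Op; have [g0 g1 g2] := cg p Op.
by split; [exact: continuousD|exact: is_deriveD|exact: continuousD].
Qed.

Lemma C1dirB e O f f' g g' : C1dir e O f f' -> C1dir e O g g' ->
  C1dir e O (fun p => f p - g p) (fun p => f' p - g' p).
Proof.
move=> cf cg p Op; have [f0 f1 f2] := cf p Op; have [g0 g1 g2] := cg p Op.
by split; [exact: continuousB|exact: is_deriveB|exact: continuousB].
Qed.

Lemma C1dirM e O f f' g g' : C1dir e O f f' -> C1dir e O g g' ->
  C1dir e O (fun p => f p * g p) (fun p => f p * g' p + g p * f' p).
Proof.
move=> cf cg p Op; have [f0 f1 f2] := cf p Op; have [g0 g1 g2] := cg p Op.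
split; [exact: continuousM|exact: is_deriveM|].
by apply: continuousD; exact: continuousM.
Qed.

Lemma C1dir_cst e O (k : R) : C1dir e O (fun=> k) (fun=> 0).
Proof. by move=> p _; split; [exact: cvg_cst|exact: is_derive_cst|exact: cvg_cst]. Qed.

Lemma C1dir_comp e O f f' (g g' : R -> R) : C1dir e O f f' ->
  (forall p, O p -> is_derive (f p) (1 : R) g (g' (f p)) /\
                    {for f p, continuous g'}) ->
  C1dir e O (fun p => g (f p)) (fun p => g' (f p) * f' p).
Proof.
move=> cf cg p Op; have [f0 f1 f2] := cf p Op; have [g1 g2] := cg p Op.
split; [|exact: is_derive_comp1|].
- apply: (@continuous_comp _ _ _ f g) => //.
  by apply/differentiable_continuous/derivable1_diffP; have [] := g1.
- by apply: continuousM => //; exact: (@continuous_comp _ _ _ f g').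
Qed.

Lemma C1dir_fst e O : C1dir e O (fun p => p.1) (fun=> e.1).
Proof.
move=> p _; split; [exact: cvg_fst| |exact: cvg_cst].
apply: is_derive_unslice => /=.
have -> : (fun s : R => s * e.1 + p.1) = ( *%R^~ e.1) + cst p.1 by [].
have -> : e.1 = (1 : R) * e.1 + 0 by ring.
apply: is_deriveD.
have -> : *%R^~ (1 * e.1 + 0) = (id : R -> R) * cst e.1.
  by apply/funext => s; rewrite /= mul1r addr0.
apply: is_derive_eq; rewrite /= scaler0 add0r /cst; exact: mulrC.
Qed.

Lemma C1dir_snd e O : C1dir e O (fun p => p.2) (fun=> e.2).
Proof.
move=> p _; split; [exact: cvg_snd| |exact: cvg_cst].
apply: is_derive_unslice => /=.
have -> : (fun s : R => s * e.2 + p.2) = ( *%R^~ e.2) + cst p.2 by [].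
have -> : e.2 = (1 : R) * e.2 + 0 by ring.
apply: is_deriveD.
have -> : *%R^~ (1 * e.2 + 0) = (id : R -> R) * cst e.2.
  by apply/funext => s; rewrite /= mul1r addr0.
apply: is_derive_eq; rewrite /= scaler0 add0r /cst; exact: mulrC.
Qed.

(** The two derivatives agree on a neighbourhood, so continuity carries over. This allows an
    unwieldy explicit formula to be forgotten. *)
Lemma C1dir_derive e O f f' : open O -> C1dir e O f f' ->
  C1dir e O f (fun p => 'D_e f p).
Proof.
move=> oO cf p Op; have [f0 f1 f2] := cf p Op; split=> //.
have E : {near p, f' =1 (fun p => 'D_e f p)}.
  apply: filterS (open_nbhs_nbhs (conj oO Op)) => q Oq.
  by have [_ [_ ->]] := cf q Oq.
rewrite /prop_for /continuous_at -(nbhs_singleton E).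
by apply: cvg_trans f2; exact: near_eq_cvg.
Qed.

Lemma zero_ext_in O f p : O p -> (f \_ O) p = f p.
Proof. by move=> Op; rewrite patchE ifT // inE. Qed.

Lemma zero_ext_out O f p : ~ O p -> (f \_ O) p = 0.
Proof. by move=> nO; rewrite patchE ifF //; apply/negP; rewrite inE. Qed.

(** A point outside [O] lies outside the closed set [K], hence has a neighbourhood where the
    extension is zero; inside [O] nothing changes locally. No regularity of the boundary of [O] is
    involved. *)
Lemma C1dir_zero_ext e O K f f' : open O -> closed K -> K `<=` O ->
  C1dir e O f f' -> (forall p, O p -> ~ K p -> f p = 0) ->
  C1dir e setT (f \_ O) (f' \_ O).
Proof.
move=> oO cK KO cf f0.
have f'0 p : O p -> ~ K p -> f' p = 0.
  move=> Op nK; have [_ [_ <-] _] := cf p Op.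
  rewrite -(derive_cst (0 : R) p e); apply: near_eq_derive.
  have oOK : open (O `&` ~` K) by apply: openI => //; exact: closed_openC.
  by apply: filterS (open_nbhs_nbhs (conj oOK (conj Op nK))) => q [Oq nKq]; exact: f0.
move=> p _; have [Op|nOp] := pselect (O p).
  have nO := open_nbhs_nbhs (conj oO Op).
  have patchO (h : P -> R) : {near p, h =1 h \_ O}.
    by apply: filterS nO => q Oq; rewrite patchE ifT ?inE.
  have [c0 c1 c2] := cf p Op.
  have pc (h : P -> R) : {for p, continuous h} -> {for p, continuous (h \_ O)}.
    move=> ch; rewrite /prop_for /continuous_at -(nbhs_singleton (patchO h)).
    by apply: cvg_trans ch; exact: near_eq_cvg (patchO h).
  split; [exact: pc| |exact: pc].
  by rewrite -(nbhs_singleton (patchO f')); exact: near_eq_is_derive c1.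
have nK : nbhs p (~` K) by apply: open_nbhs_nbhs; split; [exact: closed_openC|move/KO].
have patchO (h : P -> R) : (forall q, O q -> ~ K q -> h q = 0) -> {near p, cst 0 =1 h \_ O}.
  move=> h0; apply: filterS nK => q nKq; rewrite patchE.
  by case: ifPn => //; rewrite inE => Oq; rewrite h0.
have pc (h : P -> R) : (forall q, O q -> ~ K q -> h q = 0) -> {for p, continuous (h \_ O)}.
  move=> /patchO ch; rewrite /prop_for /continuous_at -(nbhs_singleton ch).
  have c : {for p, continuous (cst 0 : P -> R)} by exact: cst_continuous.
  by apply: cvg_trans c; exact: near_eq_cvg ch.
split; [exact: pc| |exact: pc].
rewrite -(nbhs_singleton (patchO f' f'0)).
by apply: near_eq_is_derive (patchO f f0) _; exact: is_derive_cst.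
Qed.

(** The mean value theorem is applied twice: along [e] to the increment of [u] in direction [e'],
    then along [e'] to [ue]. *)
Lemma second_difference e e' O u ue uee' p (h : R) : 0 < h ->
  (forall s t, 0 <= s <= h -> 0 <= t <= h -> O (s *: e + (t *: e' + p))) ->
  C1dir e O u ue -> C1dir e' O ue uee' ->
  exists s t, [/\ 0 <= s <= h, 0 <= t <= h &
    u (h *: e + (h *: e' + p)) - u (h *: e + p) - (u (h *: e' + p) - u p)
    = h * (h * uee' (s *: e + (t *: e' + p)))].
Proof.
move=> h0 hO cu cue.
have hO0 s : 0 <= s <= h -> O (s *: e + p).
  move=> sh; have := hO s 0 sh; rewrite scale0r add0r; apply.
  by rewrite lexx ltW.
have hOh s : 0 <= s <= h -> O (s *: e + (h *: e' + p)).
  by move=> sh; apply: hO => //; rewrite lexx ltW.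
pose F s := u (s *: e + (h *: e' + p)) - u (s *: e + p).
pose F' s := ue (s *: e + (h *: e' + p)) - ue (s *: e + p).
have dF s : 0 <= s <= h -> is_derive s (1 : R) F (F' s).
  move=> sh; have [_ d1 _] := cu _ (hOh s sh); have [_ d2 _] := cu _ (hO0 s sh).
  by apply: is_deriveB; exact: is_derive_slice.
have within_of (G G' : R -> R) : (forall s, 0 <= s <= h -> is_derive s (1 : R) G (G' s)) ->
    {within `[0, h], continuous G}.
  move=> dG; apply: continuous_in_subspaceT => s; rewrite inE /= in_itv /= => sh.
  by apply/differentiable_continuous/derivable1_diffP; case: (dG s sh).
have [|s sI E1] := @MVT R F F' 0 h h0 _ (within_of _ F' dF).
  by move=> x; rewrite in_itv /= => /andP[/ltW ? /ltW ?]; apply: dF; apply/andP.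
have sh : 0 <= s <= h by move: sI; rewrite in_itv /= => /andP[/ltW -> /ltW ->].
pose G t := ue (t *: e' + (s *: e + p)).
pose G' t := uee' (t *: e' + (s *: e + p)).
have dG t : 0 <= t <= h -> is_derive t (1 : R) G (G' t).
  move=> th; apply: is_derive_slice; rewrite /G' addrCA.
  by have [_ d _] := cue _ (hO s t sh th).
have [|t tI E2] := @MVT R G G' 0 h h0 _ (within_of _ G' dG).
  by move=> x; rewrite in_itv /= => /andP[/ltW ? /ltW ?]; apply: dG; apply/andP.
have th : 0 <= t <= h by move: tI; rewrite in_itv /= => /andP[/ltW -> /ltW ->].
exists s, t; split => //.
move: E1 E2; rewrite /F /F' /G /G' !scale0r !add0r !subr0.
rewrite (addrCA (h *: e')) (addrCA (t *: e')) => -> ->.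
by ring.
Qed.

(** Schwarz's theorem: the second difference is symmetric in the two directions, so [u12] and [u21]
    take a common value at points arbitrarily close to [p]. Symmetry is not built into [C2_on], and
    d(du) = 0 rests on it. *)
Lemma mixed_derivatives O u u1 u2 u12 u21 p : open O -> O p ->
  C1dir (e1 R) O u u1 -> C1dir (e2 R) O u u2 ->
  C1dir (e2 R) O u1 u12 -> C1dir (e1 R) O u2 u21 -> u12 p = u21 p.
Proof.
move=> oO Op cu1 cu2 cu12 cu21; apply/eqP/negP => /negP ne.
have d0 : 0 < `|u12 p - u21 p| / 2 by rewrite divr_gt0 // normr_gt0 subr_eq0.
have [_ _ c12] := cu12 p Op; have [_ _ c21] := cu21 p Op.
have n12 : \forall q \near p, `|u12 p - u12 q| < `|u12 p - u21 p| / 2.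
  by move/cvgrPdist_lt : c12; apply.
have n21 : \forall q \near p, `|u21 p - u21 q| < `|u12 p - u21 p| / 2.
  by move/cvgrPdist_lt : c21; apply.
have [r r0 rP] := nbhs_square (filterI (open_nbhs_nbhs (conj oO Op)) (filterI n12 n21)).
have h0 : 0 < r / 2 by lra.
have near12 s t : 0 <= s <= r / 2 -> 0 <= t <= r / 2 ->
    [/\ O (s *: e1 R + (t *: e2 R + p)),
     `|u12 p - u12 (s *: e1 R + (t *: e2 R + p))| < `|u12 p - u21 p| / 2 &
     `|u21 p - u21 (s *: e1 R + (t *: e2 R + p))| < `|u12 p - u21 p| / 2].
  move=> /andP[s0 sr] /andP[t0 tr].
  have [] := rP (s *: e1 R + (t *: e2 R + p)).
  - by rewrite /= [_%:A]mulr1 scaler0 add0r addrK ger0_norm //; lra.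
  - by rewrite /= [_%:A]mulr1 scaler0 add0r addrK ger0_norm //; lra.
  by move=> ? [].
have O12 s t : 0 <= s <= r / 2 -> 0 <= t <= r / 2 ->
    O (s *: e1 R + (t *: e2 R + p)).
  by move=> sh th; have [] := near12 s t sh th.
have O21 t s : 0 <= t <= r / 2 -> 0 <= s <= r / 2 ->
    O (t *: e2 R + (s *: e1 R + p)).
  by move=> th sh; rewrite addrCA; exact: O12.
have [s [t [sh th E]]] := second_difference h0 O12 cu1 cu12.
have [t' [s' [th' sh' E']]] := second_difference h0 O21 cu2 cu21.
move: E'; rewrite (addrCA (_ *: e2 R)) (addrCA (t' *: e2 R)) => E'.
have [_ a1 _] := near12 s t sh th; have [_ _ a2] := near12 s' t' sh' th'.
set q := s *: _ + _ in E a1; set q' := s' *: _ + _ in E' a2.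
have Eq : u12 q = u21 q'.
  have h1 : r / 2 != 0 by rewrite gt_eqF.
  by apply: (mulfI h1); apply: (mulfI h1); rewrite -E -E'; ring.
move: a1 a2; rewrite Eq; move: (u21 q') => z.
have := ler_distD z (u12 p) (u21 p); rewrite (distrC z); lra.
Qed.

End DirectionalC1.

(** * Cutoff functions *)

Section Cutoffs.
Variable R : realType.
Local Notation P := (R * R)%type.
Implicit Types (p q c : P) (r t : R).

(** The square makes the positive part C1, with continuous derivative [dpos2]. *)
Definition pos2 t : R := Num.max 0 t ^+ 2.
Definition dpos2 t : R := 2 * Num.max 0 t.

Lemma is_derive_pos2 t : is_derive t (1 : R) pos2 (dpos2 t).
Proof.
have [t0|t0|<-] := ltgtP 0 t.
- have E : \near t, (id ^+ 2 : R -> R) t = pos2 t.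
    by near=> s; rewrite /pos2 max_r //; apply: ltW; near: s; exact: lt_nbhsr.
  apply: near_eq_is_derive E _; apply: is_derive_eq.
  by rewrite /dpos2 max_r ?ltW // expr1 /= [_%:A]mulr1.
- have E : \near t, (cst 0 : R -> R) t = pos2 t.
    by near=> s; rewrite /pos2 max_l ?expr0n //; apply: ltW; near: s; exact: lt_nbhsl.
  apply: near_eq_is_derive E _; apply: is_derive_eq.
  by rewrite /dpos2 max_l ?ltW // mulr0.
(* At the kink the difference quotient is at most |h| in absolute value. *)
- have L : (fun h : R => h^-1 *: ((pos2 \o shift 0) (h *: 1) - pos2 0)) @ 0^' --> (0 : R).
    apply/cvgr0Pnorm_lt => e e0; near=> h.
    have h0 : h != 0 by near: h; exact: nbhs_dnbhs_neq.
    rewrite /= /shift /= addr0 /pos2 maxxx expr0n /= subr0 [_%:A]mulr1 normrM normrX normfV.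
    have he : `|h| < e.
      near: h; apply: dnbhs0_lt => //.
    apply: le_lt_trans he; rewrite ler_pdivrMl ?normr_gt0 // -expr2.
    apply: lerXn2r; rewrite ?nnegrE ?normr_ge0 //.
    have [h1|h1] := leP 0 h; first by [].
    by rewrite normr0.
  split; first by apply/cvg_ex; exists 0.
  by rewrite /dpos2 maxxx mulr0; apply: cvg_lim.
Unshelve. all: by end_near. Qed.

Lemma continuous_dpos2 : continuous dpos2.
Proof.
move=> t; apply: cvgM; first exact: cvg_cst.
by apply: (@continuous_max _ _ (fun=> 0) id); [exact: cvg_cst|exact: cvg_id].
Qed.

Lemma pos2_ge0 t : 0 <= pos2 t. Proof. exact: sqr_ge0. Qed.
Lemma dpos2_ge0 t : 0 <= dpos2 t.
Proof. by rewrite mulr_ge0 // le_max lexx. Qed.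
Lemma pos2_le0 t : t <= 0 -> pos2 t = 0.
Proof. by move=> t0; rewrite /pos2 max_l // expr0n. Qed.
Lemma pos2_gt0 t : 0 < t -> 0 < pos2 t.
Proof. by move=> t0; rewrite /pos2 max_r ?ltW // exprn_gt0. Qed.
Lemma dpos2_gt0 t : 0 < t -> 0 < dpos2 t.
Proof. by move=> t0; rewrite /dpos2 max_r ?ltW // mulr_gt0. Qed.
Lemma dpos2_le0 t : t <= 0 -> dpos2 t = 0.
Proof. by move=> t0; rewrite /dpos2 max_l // mulr0. Qed.
Lemma pos2_le1 t : t <= 1 -> pos2 t <= 1.
Proof.
move=> t1; by rewrite /pos2 expr_le1 // ?le_max ?lexx // ge_max t1 ler01.
Qed.
Lemma dpos2_le2 t : t <= 1 -> dpos2 t <= 2.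
Proof.
move=> t1; rewrite /dpos2.
have : Num.max 0 t <= 1 by rewrite ge_max t1 ler01.
lra.
Qed.

(** A C1 bump supported in [-1, 1]; on [-1/2, 1/2] it is at least (3/4)^2 = 9/16. *)
Definition bump t : R := pos2 (1 - t ^+ 2).
Definition dbump t : R := dpos2 (1 - t ^+ 2) * (- (2 * t)).

Lemma is_derive_bump t : is_derive t (1 : R) bump (dbump t).
Proof.
apply: (@is_derive1_comp R pos2 (fun s => 1 - s ^+ 2)); first exact: is_derive_pos2.
have -> : (fun s : R => 1 - s ^+ 2) = cst 1 - id ^+ 2 by [].
apply: is_derive_eq.
by rewrite sub0r expr1 /= [_%:A]mulr1.
Qed.

Lemma continuous_dbump : continuous dbump.
Proof.
move=> t; apply: cvgM; last first.
  by apply: cvgN; apply: cvgM; [exact: cvg_cst|exact: cvg_id].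
apply: (@continuous_comp _ _ _ (fun s : R => 1 - s ^+ 2) dpos2);
  last exact: continuous_dpos2.
by apply: cvgB; [exact: cvg_cst|exact: exprn_continuous].
Qed.

Lemma bump_ge0 t : 0 <= bump t. Proof. exact: pos2_ge0. Qed.
Lemma bump_le1 t : bump t <= 1.
Proof. by apply: pos2_le1; have := sqr_ge0 t; lra. Qed.
Lemma bump_out t : 1 <= `|t| -> bump t = 0.
Proof.
by move=> t1; apply: pos2_le0; rewrite -real_normK ?num_real //; nra.
Qed.
Lemma dbump_out t : 1 <= `|t| -> dbump t = 0.
Proof.
move=> t1; rewrite /dbump dpos2_le0 ?mul0r // -real_normK ?num_real //; nra.
Qed.
Lemma dbump_le t : `|dbump t| <= 4.
Proof.
have [t1|t1] := leP 1 `|t|; first by rewrite dbump_out // normr0.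
rewrite /dbump normrM normrN (ger0_norm (dpos2_ge0 _)) normrM ger0_norm //.
have : dpos2 (1 - t ^+ 2) <= 2 by apply: dpos2_le2; have := sqr_ge0 t; lra.
have := dpos2_ge0 (1 - t ^+ 2); have := normr_ge0 t; nra.
Qed.
Lemma bump_in t : `|t| <= 1 / 2 -> 1 / 2 < bump t.
Proof.
move=> t1; have t2 : t ^+ 2 <= 1 / 4.
  by rewrite -real_normK ?num_real //; have := normr_ge0 t; nra.
by rewrite /bump /pos2 max_r; [nra|lra].
Qed.

(** The scale 2 * r makes the bump exceed 1/4 on the square of half-side r and vanish off the square
    of half-side 2 * r. *)
Definition bump2 c r p : R :=
  bump ((p.1 - c.1) * (2 * r)^-1) * bump ((p.2 - c.2) * (2 * r)^-1).
Definition bump2x c r p : R :=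
  bump ((p.2 - c.2) * (2 * r)^-1) * (dbump ((p.1 - c.1) * (2 * r)^-1) * (2 * r)^-1).
Definition bump2y c r p : R :=
  bump ((p.1 - c.1) * (2 * r)^-1) * (dbump ((p.2 - c.2) * (2 * r)^-1) * (2 * r)^-1).

Lemma C1dir_bump e (f f' : P -> R) (a k : R) :
  C1dir e setT f f' -> C1dir e setT (fun p : P => bump ((f p - a) * k))
    (fun p => dbump ((f p - a) * k) * (f' p * k)).
Proof.
move=> cf.
have cA : C1dir e setT (fun p => (f p - a) * k) (fun p => f' p * k).
  have := C1dirM (C1dirB cf (@C1dir_cst R e setT a)) (@C1dir_cst R e setT k).
  by congr C1dir; apply/funext => p; ring.
apply: (C1dir_comp cA) => p _; split; first exact: is_derive_bump.
exact: continuous_dbump.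
Qed.

Lemma C1dir_bump2x c r : C1dir (e1 R) setT (bump2 c r) (bump2x c r).
Proof.
have := C1dirM (C1dir_bump c.1 (2 * r)^-1 (@C1dir_fst R (e1 R) setT))
  (C1dir_bump c.2 (2 * r)^-1 (@C1dir_snd R (e1 R) setT)).
by congr C1dir; apply/funext => p; rewrite /bump2x /=; ring.
Qed.

Lemma C1dir_bump2y c r : C1dir (e2 R) setT (bump2 c r) (bump2y c r).
Proof.
have := C1dirM (C1dir_bump c.1 (2 * r)^-1 (@C1dir_fst R (e2 R) setT))
  (C1dir_bump c.2 (2 * r)^-1 (@C1dir_snd R (e2 R) setT)).
by congr C1dir; apply/funext => p; rewrite /bump2y /=; ring.
Qed.

Lemma scaled_out r (a b : R) : 0 < r -> ~ `|a - b| <= 2 * r ->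
  1 <= `|(a - b) * (2 * r)^-1|.
Proof.
move=> r0 /negP; rewrite -ltNge => /ltW ab.
have r2 : 0 < 2 * r by lra.
by rewrite normrM normfV (gtr0_norm r2) ler_pdivlMr // mul1r.
Qed.

Lemma scaled_in r (a b : R) : 0 < r -> `|a - b| <= r ->
  `|(a - b) * (2 * r)^-1| <= 1 / 2.
Proof.
move=> r0 ab; have r2 : 0 < 2 * r by lra.
by rewrite normrM normfV (gtr0_norm r2) ler_pdivrMr //; lra.
Qed.

Lemma bump2_ge0 c r p : 0 <= bump2 c r p.
Proof. by rewrite mulr_ge0 // bump_ge0. Qed.
Lemma bump2_le1 c r p : bump2 c r p <= 1.
Proof. by rewrite mulr_ile1 // ?bump_ge0 ?bump_le1. Qed.
Lemma bump2_in c r p : 0 < r -> square c r p -> 1 / 4 < bump2 c r p.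
Proof.
move=> r0 /squareP[/(scaled_in r0)/bump_in a /(scaled_in r0)/bump_in b].
by rewrite /bump2; nra.
Qed.
Lemma bump2_out c r p : 0 < r -> ~ square c (2 * r) p -> bump2 c r p = 0.
Proof.
move=> r0 nS; rewrite /bump2.
have [/(scaled_out r0) a|a] := pselect (~ `|p.1 - c.1| <= 2 * r).
  by rewrite bump_out // mul0r.
have [/(scaled_out r0) b|b] := pselect (~ `|p.2 - c.2| <= 2 * r).
  by rewrite [X in _ * X]bump_out // mulr0.
by case: nS; apply/squareP; split; exact: contrapT.
Qed.
Lemma bump2x_out c r p : 0 < r -> ~ square c (2 * r) p -> bump2x c r p = 0.
Proof.
move=> r0 nS; rewrite /bump2x.
have [/(scaled_out r0) a|a] := pselect (~ `|p.1 - c.1| <= 2 * r).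
  by rewrite dbump_out // mul0r mulr0.
have [/(scaled_out r0) b|b] := pselect (~ `|p.2 - c.2| <= 2 * r).
  by rewrite bump_out // mul0r.
by case: nS; apply/squareP; split; exact: contrapT.
Qed.
Lemma bump2y_out c r p : 0 < r -> ~ square c (2 * r) p -> bump2y c r p = 0.
Proof.
move=> r0 nS; rewrite /bump2y.
have [/(scaled_out r0) a|a] := pselect (~ `|p.1 - c.1| <= 2 * r).
  by rewrite bump_out // mul0r.
have [/(scaled_out r0) b|b] := pselect (~ `|p.2 - c.2| <= 2 * r).
  by rewrite dbump_out // mul0r mulr0.
by case: nS; apply/squareP; split; exact: contrapT.
Qed.
Lemma dbump2_le r (s t : R) : 0 < r -> `|bump s * (dbump t * (2 * r)^-1)| <= 2 / r.
Proof.
move=> r0; have r2 : 0 < 2 * r by lra.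
rewrite normrM (ger0_norm (bump_ge0 s)) normrM normfV (gtr0_norm r2).
have -> : 2 / r = 4 * (2 * r)^-1 by field; lra.
rewrite mulrA ler_pM2r ?invr_gt0 //.
have := bump_ge0 s; have := bump_le1 s; have := dbump_le t.
have := normr_ge0 (dbump t); nra.
Qed.

Lemma C1dir_continuous e (f f' : P -> R) : C1dir e setT f f' -> continuous f.
Proof. by move=> cf p; have [] := cf p I. Qed.
Lemma C1dir_continuous' e (f f' : P -> R) : C1dir e setT f f' -> continuous f'.
Proof. by move=> cf p; have [] := cf p I. Qed.

Lemma continuous_norm_fun (f : P -> R) : continuous f -> continuous (fun p => `|f p|).
Proof. by move=> cf p; apply: cvg_norm; exact: cf. Qed.

(** Height 2 / r times the area (4 * r)^2 of the support: the bound is linear in [r], as a cover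
    with small total diameter requires. *)
Lemma Ibox_dbump2 B c r (g : P -> R) : 0 < B -> 0 < r -> continuous g ->
  (forall p, `|g p| <= 2 / r) -> (forall p, ~ square c (2 * r) p -> g p = 0) ->
  Ibox B (fun p => `|g p|) <= 32 * r.
Proof.
move=> B0 r0 cg gle g0.
apply: le_trans (@Ibox_square_le R B (fun p => `|g p|) c (2 * r) (2 / r) _ B0 _ _ _ _) _.
- by lra.
- exact: continuous_norm_fun.
- by rewrite divr_ge0 // ltW.
- by move=> p; rewrite normr_ge0 gle.
- by move=> p /g0 ->; rewrite normr0.
- by rewrite le_eqVlt; apply/orP; left; apply/eqP; field; lra.
Qed.

(* [F] exceeds 1 on the squares, so [pos2 (1 - F)] is a cutoff vanishing there. *)
Lemma square_cutoff (L : seq (P * R)) B : 0 < B -> (forall i, i \in L -> 0 < i.2) ->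
  exists F F1 F2 : P -> R,
  [/\ C1dir (e1 R) setT F F1, C1dir (e2 R) setT F F2, forall p, 0 <= F p,
   [/\ forall i p, i \in L -> square i.1 i.2 p -> 1 < F p &
    forall p, (forall i, i \in L -> ~ square i.1 (2 * i.2) p) -> F p = 0] &
   Ibox B (fun p => `|F1 p|) + Ibox B (fun p => `|F2 p|)
     <= 256 * \sum_(i <- L) i.2].
Proof.
move=> B0; elim: L => [_|[c r] L IH L0].
  exists (fun=> 0), (fun=> 0), (fun=> 0); split => //.
  - exact: C1dir_cst.
  - exact: C1dir_cst.
  rewrite big_nil mulr0 normr0.
  suff -> : Ibox B (fun=> (0 : R)) = 0 by rewrite addr0.
  rewrite -[LHS](_ : Ibox B (fun=> 0 * (0 : R)) = _); last first.
    by congr Ibox; apply/funext => p; rewrite mul0r.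
  by rewrite (@IboxZ R B 0 (fun=> 0)) ?mul0r //; exact: cst_continuous.
have [|F [F1 [F2 [cF1 cF2 F0 [Fin Fout] FI]]]] := IH.
  by move=> i iL; apply: L0; rewrite inE iL orbT.
have r0 : 0 < r by apply: (L0 (c, r)); rewrite inE eqxx.
(* The factor 4 lifts the lower bound 1/4 of [bump2] on the new square above 1. *)
pose G p := F p + 4 * bump2 c r p.
pose G1 p := F1 p + 4 * bump2x c r p.
pose G2 p := F2 p + 4 * bump2y c r p.
have c4 e f f' : C1dir e setT f f' -> C1dir e setT (fun p => 4 * f p) (fun p => 4 * f' p).
  move=> cf; have := C1dirM (@C1dir_cst R e setT 4) cf.
  by congr C1dir; apply/funext => p; ring.
have cG1 : C1dir (e1 R) setT G G1 by apply: C1dirD => //; exact/c4/C1dir_bump2x.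
have cG2 : C1dir (e2 R) setT G G2 by apply: C1dirD => //; exact/c4/C1dir_bump2y.
exists G, G1, G2; split => //.
- by move=> p; rewrite addr_ge0 // mulr_ge0 // bump2_ge0.
- split=> [i p|p out].
    rewrite inE => /predU1P[->|iL] ip.
      by have := bump2_in r0 ip; have := F0 p; rewrite /G; lra.
    by have := Fin i p iL ip; have := bump2_ge0 c r p; rewrite /G; lra.
  rewrite /G Fout ?bump2_out ?mulr0 ?addr0 //.
    by apply: (out (c, r)); rewrite inE eqxx.
  by move=> i iL; apply: out; rewrite inE iL orbT.
(* Each partial derivative of the new term costs 4 * 32 * r = 128 * r; the two together give the
   constant 256. *)
have part (g g' f : P -> R) : continuous f -> continuous g -> continuous g' ->
    (forall p, g' p = f p + 4 * g p) -> (forall p, `|g p| <= 2 / r) ->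
    (forall p, ~ square c (2 * r) p -> g p = 0) ->
    Ibox B (fun p => `|g' p|) <= Ibox B (fun p => `|f p|) + 128 * r.
  move=> cf cg cg' E gle g0.
  have cnf := continuous_norm_fun cf; have cng := continuous_norm_fun cg.
  have c4g : continuous (fun p => 4 * `|g p|).
    by move=> p; apply: cvgM; [exact: cvg_cst|exact: cng].
  apply: le_trans (_ : Ibox B (fun p => `|f p| + 4 * `|g p|) <= _).
    apply: le_Ibox => //; first exact: continuous_norm_fun.
      by move=> p; apply: cvgD; [exact: cnf|exact: c4g].
    by move=> p; rewrite E (le_trans (ler_normD _ _)) // normrM ger0_norm.
  rewrite IboxD // lerD2l IboxZ //.
  by have := Ibox_dbump2 B0 r0 cg gle g0; lra.
have I1 := part _ _ _ (C1dir_continuous' cF1) (C1dir_continuous' (@C1dir_bump2x c r))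
  (C1dir_continuous' cG1) (fun=> erefl) (fun p => dbump2_le _ _ r0)
  (fun p => @bump2x_out c r p r0).
have I2 := part _ _ _ (C1dir_continuous' cF2) (C1dir_continuous' (@C1dir_bump2y c r))
  (C1dir_continuous' cG2) (fun=> erefl) (fun p => dbump2_le _ _ r0)
  (fun p => @bump2y_out c r p r0).
by rewrite big_cons /=; lra.
Qed.

End Cutoffs.

(** * Covers of H1-null sets *)

Section Covering.
Variable R : realType.
Local Notation P := (R * R)%type.
Implicit Types (p q c : P) (r t : R).

(* [compact_cover] asks for a pointed space, which [R * R] is not canonically. *)
Definition pointed_plane : ptopologicalType :=
  HB.pack_for ptopologicalType P (isPointed.Build P (0, 0)).

Lemma compact_plane_cover (A : set P) : compact A -> cover_compact A.
Proof.
by have /(congr1 (@^~ A)) := @compact_cover pointed_plane; rewrite /pointed_plane => <-.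
Qed.

Lemma abs1_le_edist p q : `|p.1 - q.1| <= Defs.edist p q.
Proof.
by rewrite /Defs.edist -sqrtr_sqr ler_sqrt ?lerDl ?addr_ge0 ?sqr_ge0.
Qed.

Lemma abs2_le_edist p q : `|p.2 - q.2| <= Defs.edist p q.
Proof.
by rewrite /Defs.edist -sqrtr_sqr ler_sqrt ?lerDr ?addr_ge0 ?sqr_ge0.
Qed.

Lemma edist_le_ediam (C : set P) p q : C p -> C q -> ((Defs.edist p q)%:E <= ediam C)%E.
Proof. by move=> Cp Cq; apply: ereal_sup_ubound; right; exists p => //; exists q. Qed.

Lemma ediam_ge0 (C : set P) : (0 <= ediam C)%E.
Proof. by apply: ereal_sup_ubound; left. Qed.

Lemma H1_zero_delta (A : set P) (d : R) : 0 < d -> H1 A = 0%E -> (H1_delta d A <= 0)%E.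
Proof. by move=> d0 <-; apply: ereal_sup_ubound; exists d. Qed.

Lemma sum_halves (e : R) n : 0 < e -> \sum_(0 <= i < n) e / 2 ^+ i.+1 <= e.
Proof.
move=> e0; have : \sum_(0 <= i < n) e / 2 ^+ i.+1 = e - e / 2 ^+ n.
  elim: n => [|n IH]; first by rewrite big_geq // expr0 divr1 subrr.
  rewrite big_nat_recr //= IH exprS; field.
  by rewrite expf_neq0.
move=> ->; rewrite gerBl divr_ge0 ?exprn_ge0 //; exact: ltW.
Qed.

(** Each covering set that meets [A] is placed in an open square centred at one of its points in
    [A], slightly larger than its diameter; compactness extracts a finite cover. Centres in [A] and
    radii at most [rho] later keep the squares away from a given regular point. *)
Lemma H1_zero_cover (A : set P) (e rho : R) : 0 < e -> 0 < rho -> compact A ->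
  H1 A = 0%E ->
  exists L : seq (P * R), [/\
    forall i, i \in L -> [/\ 0 < i.2, i.2 <= rho & A i.1],
    forall p, A p -> exists2 i, i \in L & square i.1 i.2 p &
    \sum_(i <- L) i.2 <= e].
Proof.
move=> e0 rho0 cA HA.
(* Total enlargement allowed: half of each budget, the other half being left to the diameters. *)
pose m := Num.min (e / 2) (rho / 2).
have m0 : 0 < m by rewrite lt_min; apply/andP; split; lra.
have rho2 : 0 < rho / 2 by lra.
have [_ [C [AC Cd] <-] Csum] : exists2 x, [set (\sum_(0 <= i <oo) ediam (C i))%E |
             C in [set C : nat -> set P |
                   A `<=` \bigcup_i C i /\ forall i, (ediam (C i) <= (rho / 2)%:E)%E]] x
   & (x < (e / 2)%:E)%E.
  apply/ereal_inf_lt; apply: le_lt_trans (H1_zero_delta rho2 HA) _.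
  by rewrite lte_fin; lra.
have Cfin i : ediam (C i) = (fine (ediam (C i)))%:E.
  rewrite fineK // ge0_fin_numE ?ediam_ge0 //; exact: le_lt_trans (Cd i) (ltry _).
pose d i := fine (ediam (C i)).
have d0 i : 0 <= d i by rewrite fine_ge0 // ediam_ge0.
have dr i : d i <= rho / 2 by rewrite -lee_fin -Cfin.
(* The geometric slack keeps the radius positive for a set of diameter 0 and makes the inclusion in
   the open square strict. *)
pose r i := d i + m / 2 ^+ i.+1.
have mi i : 0 < m / 2 ^+ i.+1 by rewrite divr_gt0 // exprn_gt0.
have r0 i : 0 < r i by rewrite ltr_wpDl.
pose D := [set i : nat | exists p, C i p /\ A p].
have /choice[c cP] i : exists p, D i -> C i p /\ A p.
  by have [[p pP]|n] := pselect (D i); [exists p|exists (0, 0)].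
have := compact_plane_cover cA.
move=> /(_ nat D (fun i => ball (c i) (r i))) [].
- by move=> i _; exact: ball_open.
- move=> p Ap; have [i _ Ci] := AC p Ap.
  have Di : D i by exists p.
  exists i => //; have [Cci _] := cP i Di.
  have := edist_le_ediam Cci Ci; rewrite Cfin lee_fin => di.
  have ri := mi i.
  split; rewrite /ball /=.
    by rewrite (le_lt_trans (abs1_le_edist _ _)) // (le_lt_trans di) // ltrDl.
  by rewrite (le_lt_trans (abs2_le_edist _ _)) // (le_lt_trans di) // ltrDl.
move=> S SD Scov.
(* The list takes all indices of [D] below [n], not only those of the subcover: the whole series is
   already bounded, so the extra squares cost nothing. *)
pose n := (\max_(i <- finmap.enum_fset S) i).+1.
exists [seq (c i, r i) | i <- index_iota 0 n & `[< D i >]]; split.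
- move=> _ /mapP[i + ->]; rewrite mem_filter => /andP[/asboolP Di _] /=; split => //.
    suff : m / 2 ^+ i.+1 <= rho / 2 by have := dr i; rewrite /r; lra.
    rewrite ler_pdivrMr ?exprn_gt0 //.
    have : 1 <= 2 ^+ i.+1 :> R by rewrite exprn_ege1 // ler1n.
    have : m <= rho / 2 by rewrite ge_min lexx orbT.
    nra.
  by have [] := cP i Di.
- move=> p Ap; have [i Si ip] := Scov p Ap.
  exists (c i, r i).
    apply/mapP; exists i => //; rewrite mem_filter mem_index_iota ltnS.
    rewrite /= (@leq_bigmax_seq _ (finmap.enum_fset S) xpredT (fun i => i) i Si isT) andbT.
    by apply/asboolP; have := SD i Si; rewrite inE.
  by case: ip => b1 b2; apply/squareP; split; rewrite /= distrC ltW.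
rewrite big_map big_filter /=.
apply: le_trans (_ : \sum_(0 <= i < n) r i <= _).
  rewrite [leRHS](bigID (fun i => `[< D i >])) /= lerDl.
  by apply: sumr_ge0 => i _; exact: ltW.
rewrite /r big_split /=.
have s1 : \sum_(0 <= i < n) d i <= e / 2.
  rewrite -lee_fin; apply: le_trans (ltW Csum).
  rewrite -sumEFin; under eq_bigr do rewrite -Cfin.
  by apply: nneseries_lim_ge => i _ _; exact: ediam_ge0.
have s2 := sum_halves n m0.
have : m <= e / 2 by rewrite ge_min lexx.
lra.
Qed.

End Covering.

(** * Normalized fields *)

Section UnitField.
Variable R : realType.
Local Notation P := (R * R)%type.
Implicit Types (O K : set P) (e p q : P) (f g w : P -> R).

(** With d the scalar product, [D] = (A + B)(AB - d)/(AB). Lagrange's identity, d^2 plus the squared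
    determinant equals (AB)^2, gives d <= AB, strictly when the determinant is nonzero. *)
Lemma unit_fields_monotone (a1 a2 b1 b2 : R) :
  let A := Num.sqrt (a1 ^+ 2 + a2 ^+ 2) in
  let B := Num.sqrt (b1 ^+ 2 + b2 ^+ 2) in
  let D := (a1 - b1) * (a1 / A - b1 / B) + (a2 - b2) * (a2 / A - b2 / B) in
  0 < A -> 0 < B -> 0 <= D /\ (a1 * b2 - a2 * b1 != 0 -> 0 < D).
Proof.
move=> A B D A0 B0.
have A2 : A ^+ 2 = a1 ^+ 2 + a2 ^+ 2 by rewrite sqr_sqrtr // addr_ge0 // sqr_ge0.
have B2 : B ^+ 2 = b1 ^+ 2 + b2 ^+ 2 by rewrite sqr_sqrtr // addr_ge0 // sqr_ge0.
have AB0 : 0 < A * B by rewrite mulr_gt0.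
pose d := a1 * b1 + a2 * b2.
have d2 : d ^+ 2 + (a1 * b2 - a2 * b1) ^+ 2 = (A * B) ^+ 2.
  by rewrite exprMn A2 B2 /d; ring.
have E : D = (A + B) * (A * B - d) / (A * B).
  have -> : D = (a1 ^+ 2 + a2 ^+ 2) / A + (b1 ^+ 2 + b2 ^+ 2) / B - d * (A^-1 + B^-1).
    by rewrite /D /d; ring.
  by rewrite -A2 -B2; field; rewrite !gt_eqF.
have S0 : 0 < A + B by rewrite addr_gt0.
rewrite E; split=> [|ne].
  apply: divr_ge0; last exact: ltW.
  apply: mulr_ge0; first exact: ltW.
  rewrite subr_ge0 leNgt; apply/negP => lt.
  have := sqr_ge0 (a1 * b2 - a2 * b1); nra.
apply: divr_gt0 => //; rewrite mulr_gt0 // subr_gt0 ltNge; apply/negP => le.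
have : 0 < (a1 * b2 - a2 * b1) ^+ 2 by rewrite exprn_even_gt0.
nra.
Qed.

(** At a zero of the field the quotient is 0, since the inverse of 0 is 0; the bound thus holds at
    singular points too. *)
Lemma norm_unit_le1 (a b : R) : `|a / Num.sqrt (a ^+ 2 + b ^+ 2)| <= 1.
Proof.
set s := Num.sqrt _; have s0 : 0 <= s by exact: sqrtr_ge0.
have as_ : `|a| <= s.
  by rewrite -sqrtr_sqr ler_sqrt ?lerDl ?addr_ge0 ?sqr_ge0.
have [s1|s1] := ltP 0 s; last first.
  have -> : s = 0 by apply/eqP; rewrite eq_le s0 s1.
  by rewrite invr0 mulr0 normr0.
by rewrite normrM normfV (gtr0_norm s1) ler_pdivrMr // mul1r.
Qed.

Lemma sum_sqr_gt0 (a b : R) : ~ (a = 0 /\ b = 0) -> 0 < a ^+ 2 + b ^+ 2.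
Proof.
move=> ab; rewrite lt_neqAle addr_ge0 ?sqr_ge0 // andbT eq_sym.
by rewrite paddr_eq0 ?sqr_ge0 // !sqrf_eq0; apply/negP => /andP[/eqP ? /eqP ?]; apply: ab.
Qed.

Lemma C1dir_normalize e O a b a' b' : open O ->
  C1dir e O a a' -> C1dir e O b b' -> (forall p, O p -> ~ (a p = 0 /\ b p = 0)) ->
  C1dir e O (fun p => a p / Num.sqrt (a p ^+ 2 + b p ^+ 2))
    (fun p => 'D_e (fun p => a p / Num.sqrt (a p ^+ 2 + b p ^+ 2)) p).
Proof.
move=> oO ca cb ab0.
have cs : C1dir e O (fun p => a p ^+ 2 + b p ^+ 2)
    (fun p => (a p * a' p + a p * a' p) + (b p * b' p + b p * b' p)).
  by apply: C1dirD; exact: C1dirM.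
have ds (s : R) : 0 < s -> is_derive s (1 : R) (fun s => (Num.sqrt s)^-1)
    (- (Num.sqrt s) ^- 2 * (2 * Num.sqrt s)^-1) /\
    {for s, continuous (fun s => - (Num.sqrt s) ^- 2 * (2 * Num.sqrt s)^-1)}.
  move=> s0; have r0 : Num.sqrt s != 0 by rewrite gt_eqF // sqrtr_gt0.
  have cq : {for s, continuous (@Num.sqrt R)} by exact: sqrt_continuous.
  split.
    have [d1 d2] := is_derive1_sqrt s0.
    split; first exact: derivableV.
    by rewrite deriveV // d2.
  apply: cvgM.
    apply: cvgN; apply: cvgV; first by rewrite expf_neq0.
    apply: (@continuous_comp _ _ _ (@Num.sqrt R) (fun x => x ^+ 2)) => //.
    exact: exprn_continuous.
  by apply: cvgV; [rewrite mulf_neq0|apply: cvgM => //; exact: cvg_cst].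
have ci := C1dir_comp cs (fun p Op => ds _ (sum_sqr_gt0 (ab0 p Op))).
exact: C1dir_derive oO (C1dirM ca ci).
Qed.

Lemma C1_on_C1dir O f : (forall p, O p -> {for p, continuous f}) -> C1_on O f ->
  C1dir (e1 R) O f (px f) /\ C1dir (e2 R) O f (py f).
Proof.
move=> cf cO; split=> p Op; have [d1 d2 c1 c2] := cO p Op; split=> //.
- exact: cf.
- exact: cf.
Qed.

End UnitField.

(** * The comparison principle *)

Section Comparison.
Variable R : realType.
Local Notation P := (R * R)%type.
Variables (Om : set P) (u v : P -> R).
Hypotheses (oOm : open Om) (bOm : bounded_set Om).
Hypotheses (C2u : C2_on Om u) (C2v : C2_on Om v).
Hypotheses (cu : {within closure Om, continuous u})
           (cv : {within closure Om, continuous v}).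
Hypothesis bdry : forall p, (closure Om `\` Om) p -> u p <= v p.

Let w p := u p - v p.

(** Strict inequalities put the edges of the box outside the domain, where fields extended by zero
    vanish. *)
Lemma domain_in_box : exists2 B : R, 0 < B &
  forall p, Om p -> `|p.1| < B /\ `|p.2| < B.
Proof.
have [M [_ HM]] := bOm; exists (`|M| + 1 + 1); first by have := normr_ge0 M; lra.
move=> p Op; have : `|p| <= `|M| + 1.
  by apply: (HM (`|M| + 1)) => //; have := ler_norm M; lra.
have := ler_norm M; rewrite prod_normE ge_max => _ /andP[? ?]; split; lra.
Qed.

Lemma compact_closure_domain : compact (closure Om).
Proof.
have [B B0 BO] := domain_in_box.
apply: (subclosed_compact _ (@compact_square R (0, 0) B)); first exact: closed_closure.
have cS : closed (@square R (0, 0) B).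
  by apply: compact_closed; [exact: norm_hausdorff|exact: compact_square].
rewrite [X in _ `<=` X](closure_id _).1 //; apply: closureS => p /BO[b1 b2].
by apply/squareP; rewrite !subr0 !ltW.
Qed.

Lemma continuous_domain (f : P -> R) : {within closure Om, continuous f} ->
  forall p, Om p -> {for p, continuous f}.
Proof.
move=> cf p Op.
have : {within Om, continuous f} by apply: continuous_subspaceW cf; exact: subset_closure.
by rewrite continuous_open_subspace // => /(_ p); apply; rewrite inE.
Qed.

Lemma within_w : {within closure Om, continuous w}.
Proof. by move=> p; apply: continuousB; [exact: cu|exact: cv]. Qed.

(** Closedness in the whole plane, not just in [Om], comes from the continuity of [w] up to the
    boundary. *)
Lemma superlevel_closed (a : R) : closed [set p | closure Om p /\ a <= w p].
Proof.
move=> p Kp.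
have cp : closure Om p.
  by apply: (@closed_closure _ Om); apply: closureS Kp => q [].
split=> //; rewrite leNgt; apply/negP => lt.
have /subspace_continuousP/(_ p cp) cw := within_w.
have : \forall q \near p, closure Om q -> w q < a.
  have := cw [set x | x < a] (lt_nbhsl _); apply.
  by [].
move=> /Kp[q [[cq aq] /(_ cq)]]; lra.
Qed.

(** This is where the boundary inequality enters: a positive level cannot be reached on the
    boundary. *)
Lemma superlevel_domain (a : R) p : 0 < a -> closure Om p -> a <= w p -> Om p.
Proof.
move=> a0 cp ap; apply: contrapT => nO.
have := bdry (conj cp nO); move: ap; rewrite /w; lra.
Qed.

Lemma w_bounded : exists2 W : R, 0 < W & forall p, Om p -> w p <= W.
Proof.
have := continuous_compact within_w compact_closure_domain.
move=> /compact_bounded[M [_ HM]].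
exists (`|M| + 1); first by have := normr_ge0 M; lra.
move=> p Op; apply: le_trans (ler_norm _) _.
apply: (HM (`|M| + 1)); first by have := ler_norm M; lra.
by exists p => //; exact: subset_closure.
Qed.

(** The cross derivatives are f_xy - 1 and f_yx + 1. By symmetry of the mixed derivatives they
    differ by exactly 2, the source of the 2 in the exterior derivative of theta. *)
Lemma horizontal_gradient_C1 (f : P -> R) : {within closure Om, continuous f} ->
  C2_on Om f ->
  [/\ C1dir (e1 R) Om f (px f), C1dir (e2 R) Om f (py f),
      C1dir (e1 R) Om (fun p => px f p - p.2) (px (px f)) &
      C1dir (e2 R) Om (fun p => py f p + p.1) (py (py f))] /\
  (C1dir (e2 R) Om (fun p => px f p - p.2) (fun p => py (px f) p - 1) /\
   C1dir (e1 R) Om (fun p => py f p + p.1) (fun p => px (py f) p + 1)) /\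
  {in Om, py (px f) =1 px (py f)}.
Proof.
move=> cf [C1 Cx Cy].
have [f1 f2] := C1_on_C1dir (continuous_domain cf) C1.
have cx p : Om p -> {for p, continuous (px f)} by move=> /f1[].
have cy p : Om p -> {for p, continuous (py f)} by move=> /f2[].
have [x1 x2] := C1_on_C1dir cx Cx.
have [y1 y2] := C1_on_C1dir cy Cy.
have A1 : C1dir (e1 R) Om (fun p => px f p - p.2) (px (px f)).
  have := C1dirB x1 (@C1dir_snd R (e1 R) Om).
  by congr C1dir; apply/funext => p /=; rewrite subr0.
have A2 : C1dir (e2 R) Om (fun p => py f p + p.1) (py (py f)).
  have := C1dirD y2 (@C1dir_fst R (e2 R) Om).
  by congr C1dir; apply/funext => p /=; rewrite addr0.
have B1 := C1dirB x2 (@C1dir_snd R (e2 R) Om).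
have B2 := C1dirD y1 (@C1dir_fst R (e1 R) Om).
split; first by split; [exact: f1|exact: f2|exact: A1|exact: A2].
split; first by split; [exact: B1|exact: B2].
by move=> p; rewrite inE => Op; exact: (mixed_derivatives oOm Op f1 f2 x2 y1).
Qed.

Let S := closure (Sing Om u `|` Sing Om v).
Let O := Om `&` ~` S.

Lemma regular_near (f : P -> R) p : {within closure Om, continuous f} ->
  C2_on Om f -> Om p -> ~ Sing Om f p -> \forall q \near p, ~ Sing Om f q.
Proof.
move=> cf C2 Op nS; have [[_ _ a1 a2] _] := horizontal_gradient_C1 cf C2.
have [c1 _ _] := a1 p Op; have [c2 _ _] := a2 p Op.
have pos : 0 < (px f p - p.2) ^+ 2 + (py f p + p.1) ^+ 2.
  by apply: sum_sqr_gt0 => -[? ?]; apply: nS.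
have cs : {for p, continuous (fun q => (px f q - q.2) ^+ 2 + (py f q + q.1) ^+ 2)}.
  by apply: continuousD; apply: continuousM.
have : \forall q \near p, 0 < (px f q - q.2) ^+ 2 + (py f q + q.1) ^+ 2.
  exact: (cvgr_gt _ cs _ pos).
apply: filterS => q /= + [_ [z1 z2]].
by rewrite z1 z2 expr0n addr0 ltxx.
Qed.

(** The singular set is relatively closed in [Om], so taking its closure adds only points outside
    [Om]. *)
Lemma regularP p : Om p -> ~ (Sing Om u `|` Sing Om v) p -> O p.
Proof.
move=> Op nS; split=> // Sp.
have nu := @regular_near u p cu C2u Op (fun h => nS (or_introl h)).
have nv := @regular_near v p cv C2v Op (fun h => nS (or_intror h)).
by have [q [[]]] := Sp _ (filterI nu nv); move=> ? [].
Qed.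

Lemma open_regular : open O.
Proof. by apply: openI => //; exact/closed_openC/closed_closure. Qed.

Lemma regular_nSing p : O p -> ~ (Sing Om u `|` Sing Om v) p.
Proof. by move=> [_ nS] /subset_closure. Qed.

Lemma unit_field_C1 (f : P -> R) : {within closure Om, continuous f} ->
  C2_on Om f -> (forall p, O p -> ~ Sing Om f p) ->
  C1dir (e1 R) O (N1 f) (px (N1 f)) /\ C1dir (e2 R) O (N2 f) (py (N2 f)).
Proof.
move=> cf C2 nS; have [[_ _ a1 a2] [[b1 b2] _]] := horizontal_gradient_C1 cf C2.
have OO : O `<=` Om by move=> p [].
have nz p : O p -> ~ (px f p - p.2 = 0 /\ py f p + p.1 = 0).
  by move=> Op [? ?]; apply: (nS p Op); split; [exact: OO|].
have nz' p : O p -> ~ (py f p + p.1 = 0 /\ px f p - p.2 = 0).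
  by move=> Op [? ?]; exact: (nz p Op).
split.
  exact: C1dir_normalize open_regular (C1dirS OO a1) (C1dirS OO b2) nz.
(* The second component is normalized with the roles of the two components exchanged. *)
have := C1dir_normalize open_regular (C1dirS OO a2) (C1dirS OO b1) nz'.
have -> : (fun p => (py f p + p.1) /
    Num.sqrt ((py f p + p.1) ^+ 2 + (px f p - p.2) ^+ 2)) = N2 f.
  by apply/funext => p; rewrite /N2 /Nden (addrC ((px f p - p.2) ^+ 2)).
by apply.
Qed.

Definition excess (a : R) p : R := pos2 (w p - a).

Lemma C1dir_w : C1dir (e1 R) Om w (fun p => px u p - px v p) /\
  C1dir (e2 R) Om w (fun p => py u p - py v p).
Proof.
have [[u1 u2 _ _] _] := horizontal_gradient_C1 cu C2u.
have [[v1 v2 _ _] _] := horizontal_gradient_C1 cv C2v.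
by split; exact: C1dirB.
Qed.

Lemma C1dir_excess e w' (a : R) : C1dir e Om w w' ->
  C1dir e Om (excess a) (fun p => dpos2 (w p - a) * w' p).
Proof.
move=> cw; have cwa : C1dir e Om (fun p => w p - a) w'.
  have := C1dirB cw (@C1dir_cst R e Om a).
  by congr C1dir; apply/funext => p; rewrite subr0.
apply: (C1dir_comp cwa) => p _; split; first exact: is_derive_pos2.
exact: continuous_dpos2.
Qed.

Hypothesis divN_le : forall p, Om p -> ~ (Sing Om u `|` Sing Om v) p ->
  divN v p <= divN u p.
Hypothesis H1S : H1 S = 0%E.

Let a1 (f : P -> R) p := px f p - p.2.
Let a2 (f : P -> R) p := py f p + p.1.

(** The pairing of grad w with N(u) - N(v). *)
Let jump p := (px u p - px v p) * (N1 u p - N1 v p) + (py u p - py v p) * (N2 u p - N2 v p).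

Lemma Nden_gt0 (f : P -> R) p : Om p -> ~ Sing Om f p -> 0 < Nden f p.
Proof.
move=> Op nS; rewrite /Nden sqrtr_gt0; apply: sum_sqr_gt0 => -[? ?]; exact: nS.
Qed.

Lemma jump_ge0 p : O p -> 0 <= jump p /\
  (a1 u p * a2 v p - a2 u p * a1 v p != 0 -> 0 < jump p).
Proof.
move=> Op; have nS := regular_nSing Op; have [Omp _] := Op.
have := unit_fields_monotone (Nden_gt0 Omp (fun h => nS (or_introl h)))
  (Nden_gt0 Omp (fun h => nS (or_intror h))).
have -> : (px u p - p.2 - (px v p - p.2)) = px u p - px v p by ring.
have -> : (py u p + p.1 - (py v p + p.1)) = py u p - py v p by ring.
by [].
Qed.

Lemma regular_N : [/\
  C1dir (e1 R) O (fun p => N1 u p - N1 v p) (fun p => px (N1 u) p - px (N1 v) p) &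
  C1dir (e2 R) O (fun p => N2 u p - N2 v p) (fun p => py (N2 u) p - py (N2 v) p)].
Proof.
have [u1 u2] := unit_field_C1 cu C2u (fun p Op => fun h => regular_nSing Op (or_introl h)).
have [v1 v2] := unit_field_C1 cv C2v (fun p Op => fun h => regular_nSing Op (or_intror h)).
by split; exact: C1dirB.
Qed.

Lemma norm_N1_le1 (f : P -> R) p : `|N1 f p| <= 1.
Proof. exact: norm_unit_le1. Qed.

Lemma norm_N2_le1 (f : P -> R) p : `|N2 f p| <= 1.
Proof.
by rewrite /N2 /Nden (addrC ((px f p - p.2) ^+ 2)); exact: norm_unit_le1.
Qed.

(** Here [n] stands for a component of N(u) - N(v) and the other factor for a partial derivative of
    the cutoff; the constant is 2 * 2. *)
Lemma dpos2_flux_ge (n f t : R) : t <= 1 -> `|n| <= 2 ->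
  - (4 * `|f|) <= n * (dpos2 t * (0 - f)).
Proof.
move=> t1 n2; rewrite sub0r lerNl; apply: le_trans (ler_norm _) _.
rewrite normrN normrM [X in _ * X]normrM normrN mulrA.
rewrite ler_wpM2r // (ger0_norm (dpos2_ge0 t)).
have -> : 4 = 2 * 2 :> R by ring.
by apply: ler_pM => //; [exact: dpos2_ge0|exact: dpos2_le2].
Qed.

(** The divergence of cutoff times excess times N(u) - N(v), split into the monotone pairing, the
    difference of divergences, and the error due to the cutoff. *)
Lemma divergence_expansion (ps ex d n1 n2 nu1 nv1 nu2 nv2 w1 w2 f1 f2 : R) :
  ps * (ex * (nu1 - nv1) + n1 * (d * w1)) + ex * n1 * f1 +
    (ps * (ex * (nu2 - nv2) + n2 * (d * w2)) + ex * n2 * f2) =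
  ps * (d * (w1 * n1 + w2 * n2)) + ps * ex * (nu1 + nu2 - (nv1 + nv2)) +
    ex * (n1 * f1 + n2 * f2).
Proof. ring. Qed.

(** Here (a, b) are the coefficients of theta and [m] is the common mixed derivative; the last term
    is the wedge of d(excess) with theta. *)
Lemma curl_expansion (ex d w1 w2 a b m : R) :
  ex * (m + 1) + b * (d * w1) - (ex * (m - 1) + a * (d * w2)) =
  2 * ex + d * (w1 * b - w2 * a).
Proof. ring. Qed.

(* Test the divergence inequality against [psi * excess eps], where the cutoff [psi]
   vanishes near the singular set.  Since the unit fields are bounded, the error term
   is controlled by the L1 norm of the gradient of [psi], which is at most a multiple
   of the total side length of a cover by squares, hence arbitrarily small. *)
Lemma gradients_parallel p0 : Om p0 -> 0 < w p0 ->
  a1 u p0 * a2 v p0 - a2 u p0 * a1 v p0 = 0.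
Proof.
move=> Om0 w0; apply: contrapT => ne.
(* At a singular point one of the two vectors is zero, and so is the determinant. *)
have O0 : O p0.
  apply: regularP => // -[[_ [z1 z2]]|[_ [z1 z2]]]; apply: ne; rewrite /a1 /a2 z1 z2.
    by rewrite !mul0r subrr.
  by rewrite !mulr0 subrr.
have OO : O `<=` Om by move=> p [].
pose eps := w p0 / 2; have eps0 : 0 < eps by rewrite /eps; lra.
have [cw1 cw2] := C1dir_w.
have [cN1 cN2] := regular_N.
have cG1 := C1dirS OO (C1dir_excess eps cw1).
have cG2 := C1dirS OO (C1dir_excess eps cw2).
pose den p := dpos2 (w p - eps) * jump p.
have den0 : 0 < den p0.
  apply: mulr_gt0; last by apply: (jump_ge0 O0).2; exact/eqP.
  by apply: dpos2_gt0; rewrite /eps; lra.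
have cden : {for p0, continuous den}.
  have [_ _ g1] := cG1 p0 O0; have [_ _ g2] := cG2 p0 O0.
  have [n1 _ _] := cN1 p0 O0; have [n2 _ _] := cN2 p0 O0.
  have -> : den = (fun p => dpos2 (w p - eps) * (px u p - px v p) * (N1 u p - N1 v p)
      + dpos2 (w p - eps) * (py u p - py v p) * (N2 u p - N2 v p)).
    by apply/funext => p; rewrite /den /jump mulrDr !mulrA.
  exact: continuousD (continuousM g1 n1) (continuousM g2 n2).
pose c := den p0 / 2; have c0 : 0 < c by rewrite /c; lra.
have nden : \forall q \near p0, c < den q.
  by apply: (cvgr_gt _ cden); rewrite /c; lra.
have [s s0 sP] := nbhs_square (filterI (open_nbhs_nbhs (conj open_regular O0)) nden).
(* A bump of half-side s/4 is supported in half-side s/2, well inside the square where [den] exceeds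
   [c]. *)
have s4 : 0 < s / 4 by lra.
have Qs q : square p0 (2 * (s / 4)) q -> O q /\ c < den q.
  by move=> /squareP[? ?]; apply: sP; lra.
have [B B0 BO] := domain_in_box.
have [W W0 WO] := w_bounded.
(* Fixed before the cover is chosen, so that its integral is a gain independent of the cutoff. *)
pose bQ := bump2 p0 (s / 4).
have cbQ : continuous bQ := C1dir_continuous (@C1dir_bump2x R p0 (s / 4)).
have IQ : 0 < Ibox B bQ.
  have [p1 p2] := BO _ Om0.
  apply: (Ibox_gt0 B0 cbQ (bump2_ge0 _ _) p1 p2).
  apply: lt_trans (bump2_in s4 _) => //.
  by apply/squareP; rewrite !subrr normr0 ltW.
(* The excess is at most W^2 and each flux term contributes the factor 4. *)
pose M := 4 * W ^+ 2; have M0 : 0 < M by rewrite /M; apply: mulr_gt0; rewrite ?exprn_gt0.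
(* Since 512 = 2 * 256, the cutoff error is at most half of the gain [c * Ibox B bQ]. *)
pose eta := c * Ibox B bQ / (512 * M).
have eta0 : 0 < eta by apply: divr_gt0; [exact: mulr_gt0|lra].
have compS : compact S.
  apply: (subclosed_compact _ compact_closure_domain); first exact: closed_closure.
  by apply: closureS => p [[]|[]].
have s8 : 0 < s / 8 by lra.
have [L [LP Lcov Lsum]] := H1_zero_cover eta0 s8 compS H1S.
have L0 i : i \in L -> 0 < i.2 by move=> /LP[].
have [F [F1 [F2 [cF1 cF2 F0 [Fin Fout] FI]]]] := square_cutoff B0 L0.
(* A doubled square of half-side at most s/4 meeting this one would have its centre within 3s/4 of
   [p0], hence in [O], whereas the centre lies in [S]. *)
have FQ p : square p0 (2 * (s / 4)) p -> F p = 0.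
  move=> pQ; apply: Fout => i iL ip; have [i0 i1 Si] := LP i iL.
  move/squareP : pQ => [p1 p2]; move/squareP : ip => [q1 q2].
  have d1 : `|i.1.1 - p0.1| < s by move: p1 q1; rewrite !ler_norml ltr_norml; lra.
  have d2 : `|i.1.2 - p0.2| < s by move: p2 q2; rewrite !ler_norml ltr_norml; lra.
  by have [[_ nS] _] := sP i.1 d1 d2; exact: nS.
pose psi p := pos2 (1 - F p).
have cpsi e F' : C1dir e setT F F' ->
    C1dir e O psi (fun p => dpos2 (1 - F p) * (0 - F' p)).
  move=> cF; have cf : C1dir e setT (fun p => 1 - F p) (fun p => 0 - F' p).
    exact: C1dirB (@C1dir_cst R e setT 1) cF.
  apply: C1dirS (C1dir_comp cf _) => // p _; split; first exact: is_derive_pos2.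
  exact: continuous_dpos2.
have cX1 := C1dirM (cpsi _ _ cF1) (C1dirM cG1 cN1).
have cX2 := C1dirM (cpsi _ _ cF2) (C1dirM cG2 cN2).
(* The first condition keeps [K] off the boundary of the domain, the second off [S], since F > 1 on
   the squares that cover [S]. *)
pose K := [set p | closure Om p /\ eps <= w p] `&` [set p | F p <= 1].
have cK : closed K.
  apply: closedI; first exact: superlevel_closed.
  have : closed (F @^-1` [set x | x <= 1]).
    by apply: closed_comp; [move=> p _; exact: (C1dir_continuous cF1)|exact: closed_le].
  by [].
have KO : K `<=` O.
  move=> p [[cp wp] /= Fp]; split; first exact: superlevel_domain cp wp.
  move=> /Lcov[i iL ip]; have := Fin i p iL ip; lra.
have Xout (N : P -> R) p : O p -> ~ K p -> psi p * (excess eps p * N p) = 0.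
  move=> [Op _] nK; have [F1'|F1'] := leP (F p) 1.
    rewrite (_ : excess eps p = 0) ?mul0r ?mulr0 //; apply: pos2_le0.
    rewrite leNgt; apply/negP => lt; apply: nK; split => //; split; last by lra.
    exact: subset_closure.
  by rewrite /psi pos2_le0 ?mul0r //; lra.
have E1 := C1dir_zero_ext open_regular cK KO cX1 (Xout _).
have E2 := C1dir_zero_ext open_regular cK KO cX2 (Xout _).
set X1 := (X in C1dir _ setT (X \_ O) _) in E1;
  set X1' := (X in C1dir _ setT _ (X \_ O)) in E1.
set X2 := (X in C1dir _ setT (X \_ O) _) in E2;
  set X2' := (X in C1dir _ setT _ (X \_ O)) in E2.
have I1 : Ibox B (X1' \_ O) = 0.
  apply: (@Ibox_dx R B (X1 \_ O)) => //.
  - by move=> p; have [] := E1 p I.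
  - exact: C1dir_continuous' E1.
  - by move=> p pB; apply: zero_ext_out => -[/BO[]]; rewrite pB ltxx.
have I2 : Ibox B (X2' \_ O) = 0.
  apply: (@Ibox_dy R B (X2 \_ O)) => //.
  - by move=> p; have [] := E2 p I.
  - exact: C1dir_continuous' E2.
  - by move=> p pB; apply: zero_ext_out => -[/BO[_]]; rewrite pB ltxx.
(* Pointwise bound on the divergence of the test field, whose integral is zero; outside [O] both the
   field and [bQ] vanish. *)
have lower p : c * bQ p + (- M) * (`|F1 p| + `|F2 p|) <= (X1' \_ O) p + (X2' \_ O) p.
  have MF : 0 <= M * (`|F1 p| + `|F2 p|) by rewrite mulr_ge0 ?addr_ge0 // ltW.
  have [Op|nO] := pselect (O p); last first.
    rewrite (zero_ext_out X1' nO) (zero_ext_out X2' nO) /bQ bump2_out // => [|/Qs[]//].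
    by rewrite mulr0 mulNr add0r addr0 oppr_le0.
  rewrite (zero_ext_in X1' Op) (zero_ext_in X2' Op).
  have -> : X1' p + X2' p = psi p * den p
     + psi p * excess eps p * (divN u p - divN v p)
     + excess eps p * ((N1 u p - N1 v p) * (dpos2 (1 - F p) * (0 - F1 p))
                    + (N2 u p - N2 v p) * (dpos2 (1 - F p) * (0 - F2 p))).
    exact: divergence_expansion.
  have psi0 : 0 <= psi p by exact: pos2_ge0.
  have [Omp _] := Op.
  have ex0 : 0 <= excess eps p by exact: pos2_ge0.
  have exW : excess eps p <= W ^+ 2.
    have mx : Num.max 0 (w p - eps) <= W.
      by rewrite ge_max (ltW W0) /=; have := WO p Omp; lra.
    by rewrite /excess /pos2 lerXn2r // nnegrE ?le_max ?lexx // ltW.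
  have t1 : c * bQ p <= psi p * den p.
    have d0 : 0 <= den p by rewrite mulr_ge0 ?dpos2_ge0 //; exact: (jump_ge0 Op).1.
    have [pQ|npQ] := pselect (square p0 (2 * (s / 4)) p).
      have [_ cd] := Qs p pQ.
      rewrite /psi FQ // subr0 (_ : pos2 1 = 1); last by rewrite /pos2 max_r ?expr1n.
      have := bump2_le1 p0 (s / 4) p; have := bump2_ge0 p0 (s / 4) p; rewrite -/bQ; nra.
    by rewrite /bQ bump2_out // mulr0 mulr_ge0.
  have t2 : 0 <= psi p * excess eps p * (divN u p - divN v p).
    apply: mulr_ge0; first exact: mulr_ge0.
    by rewrite subr_ge0; apply: divN_le => //; exact: regular_nSing.
  have F1p : 1 - F p <= 1 by rewrite gerBl.
  have n1 : `|N1 u p - N1 v p| <= 2.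
    by rewrite (le_trans (ler_normB _ _)) // (lerD (norm_N1_le1 _ _) (norm_N1_le1 _ _)).
  have n2 : `|N2 u p - N2 v p| <= 2.
    by rewrite (le_trans (ler_normB _ _)) // (lerD (norm_N2_le1 _ _) (norm_N2_le1 _ _)).
  have := lerD (dpos2_flux_ge (F1 p) F1p n1) (dpos2_flux_ge (F2 p) F1p n2).
  rewrite -opprD -mulrDr => /(ler_wpM2l ex0) t3.
  have t4 : excess eps p * (4 * (`|F1 p| + `|F2 p|)) <= W ^+ 2 * (4 * (`|F1 p| + `|F2 p|)).
    by rewrite ler_wpM2r // mulr_ge0 // addr_ge0.
  have := lerD (lerD t1 t2) (le_trans _ t3); rewrite addr0; apply.
  by rewrite mulrN mulNr lerN2; apply: le_trans t4 _; rewrite /M mulrCA mulrA.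
clearbody X1 X1' X2 X2'.
have cF1' := continuous_norm_fun (C1dir_continuous' cF1).
have cF2' := continuous_norm_fun (C1dir_continuous' cF2).
have cFF : continuous (fun p => `|F1 p| + `|F2 p|).
  by move=> p; apply: cvgD; [exact: cF1'|exact: cF2'].
have cMF : continuous (fun p => - M * (`|F1 p| + `|F2 p|)).
  by move=> p; apply: cvgM; [exact: cvg_cst|exact: cFF].
have ccQ : continuous (fun p => c * bQ p).
  by move=> p; apply: cvgM; [exact: cvg_cst|exact: cbQ].
have : Ibox B (fun p => c * bQ p + (- M) * (`|F1 p| + `|F2 p|)) <=
    Ibox B (fun p => (X1' \_ O) p + (X2' \_ O) p).
  apply: le_Ibox => //.
  - by move=> p; apply: cvgD; [exact: ccQ|exact: cMF].
  - by move=> p; apply: cvgD; [exact: (C1dir_continuous' E1)|exact: (C1dir_continuous' E2)].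
rewrite (IboxD B0 (C1dir_continuous' E1) (C1dir_continuous' E2)) I1 I2 addr0.
rewrite (IboxD B0 ccQ cMF) (IboxZ c B0 cbQ) (IboxZ (- M) B0 cFF) (IboxD B0 cF1' cF2').
have : M * (Ibox B (fun p => `|F1 p|) + Ibox B (fun p => `|F2 p|)) <= M * (256 * eta).
  by apply: ler_wpM2l; [exact: ltW|apply: le_trans FI _; apply: ler_wpM2l].
have -> : M * (256 * eta) = c * Ibox B bQ / 2 by rewrite /eta; field; rewrite gt_eqF.
have := mulr_gt0 c0 IQ; lra.
Qed.

(* With [theta = a1 u dx + a2 u dy], the form [excess eps * theta] has compact support
   and exterior derivative [2 * excess eps dx dy], because [dw] is parallel to [theta]
   on [w > 0]. *)
Lemma comparison p0 : Om p0 -> w p0 <= 0.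
Proof.
move=> Om0; rewrite leNgt; apply/negP => w0.
have [eps eps0 w_eps] : exists2 a : R, 0 < a & 0 < w p0 - a by exists (w p0 / 2); lra.
have [cw1 cw2] := C1dir_w.
have [[_ _ _ _] [[A1y A2x] mixed]] := horizontal_gradient_C1 cu C2u.
have cX1 := C1dirM (C1dir_excess eps cw1) A2x.
have cX2 := C1dirM (C1dir_excess eps cw2) A1y.
pose K := [set p | closure Om p /\ eps <= w p].
have KO : K `<=` Om by move=> p [cp wp]; exact: superlevel_domain cp wp.
have Xout (N : P -> R) p : Om p -> ~ K p -> excess eps p * N p = 0.
  move=> Op nK; rewrite /excess pos2_le0 ?mul0r // leNgt; apply/negP => lt.
  by apply: nK; split; [exact: subset_closure|lra].
have E1 := C1dir_zero_ext oOm (superlevel_closed (a := eps)) KO cX1 (Xout _).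
have E2 := C1dir_zero_ext oOm (superlevel_closed (a := eps)) KO cX2 (Xout _).
set X1 := (X in C1dir _ setT (X \_ Om) _) in E1;
  set X1' := (X in C1dir _ setT _ (X \_ Om)) in E1.
set X2 := (X in C1dir _ setT (X \_ Om) _) in E2;
  set X2' := (X in C1dir _ setT _ (X \_ Om)) in E2.
have [B B0 BO] := domain_in_box.
have I1 : Ibox B (X1' \_ Om) = 0.
  apply: (@Ibox_dx R B (X1 \_ Om)) => //.
  - by move=> p; have [] := E1 p I.
  - exact: C1dir_continuous' E1.
  - by move=> p pB; apply: zero_ext_out => /BO[]; rewrite pB ltxx.
have I2 : Ibox B (X2' \_ Om) = 0.
  apply: (@Ibox_dy R B (X2 \_ Om)) => //.
  - by move=> p; have [] := E2 p I.
  - exact: C1dir_continuous' E2.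
  - by move=> p pB; apply: zero_ext_out => /BO[_]; rewrite pB ltxx.
have curl p : Om p -> X1' p - X2' p = 2 * excess eps p.
  move=> Op.
  have par : dpos2 (w p - eps) *
      ((px u p - px v p) * a2 u p - (py u p - py v p) * a1 u p) = 0.
    have [le|lt] := leP (w p) eps; first by rewrite dpos2_le0 ?mul0r ?subr_le0.
    (* As grad w = alpha - beta, its determinant with alpha reduces to that of alpha and beta. *)
    have -> : (px u p - px v p) * a2 u p - (py u p - py v p) * a1 u p =
        a1 u p * a2 v p - a2 u p * a1 v p by rewrite /a1 /a2; ring.
    by rewrite gradients_parallel ?mulr0 // (lt_trans eps0 lt).
  have := mixed p; rewrite inE => /(_ Op) mix.
  rewrite /X1' /X2' mix -[RHS]addr0 -[in RHS]par /a1 /a2.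
  exact: curl_expansion.
clearbody X1 X1' X2 X2'.
have ex0 p : 0 <= excess eps p by exact: pos2_ge0.
have cX2' : continuous (fun p => (-1) * (X2' \_ Om) p).
  by move=> p; apply: cvgM; [exact: cvg_cst|exact: (C1dir_continuous' E2)].
have cD : continuous (fun p => (X1' \_ Om) p + (-1) * (X2' \_ Om) p).
  by move=> p; apply: cvgD; [exact: (C1dir_continuous' E1)|exact: cX2'].
have : Ibox B (fun p => (X1' \_ Om) p + (-1) * (X2' \_ Om) p) = 0.
  rewrite (IboxD B0 (C1dir_continuous' E1) cX2') (IboxZ (-1) B0 (C1dir_continuous' E2)).
  by rewrite I1 I2 mulr0 addr0.
(* The integrand is nonnegative, continuous and positive at [p0], so its integral cannot be zero. *)
apply/eqP; rewrite gt_eqF //; have [p1 p2] := BO _ Om0.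
have D_in p : Om p -> (X1' \_ Om) p + -1 * (X2' \_ Om) p = 2 * excess eps p.
  by move=> Op; rewrite (zero_ext_in X1' Op) (zero_ext_in X2' Op) mulN1r; exact: curl.
apply: (Ibox_gt0 B0 cD _ p1 p2) => [p|]; last first.
  by rewrite (D_in _ Om0); apply: mulr_gt0 => //; exact: pos2_gt0.
have [Op|nO] := pselect (Om p); first by rewrite (D_in _ Op); exact: mulr_ge0.
by rewrite (zero_ext_out X1' nO) (zero_ext_out X2' nO) mulr0 addr0.
Qed.

End Comparison.

Theorem theoremC (R : realType) (Omega : set (R * R)) (u v : R * R -> R) :
  open Omega -> connected Omega -> bounded_set Omega ->
  C2_on Omega u -> C2_on Omega v ->
  {within closure Omega, continuous u} -> {within closure Omega, continuous v} ->
  (forall p, Omega p -> ~ (Sing Omega u `|` Sing Omega v) p ->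
     divN v p <= divN u p) ->
  (forall p, (closure Omega `\` Omega) p -> u p <= v p) ->
  H1 (closure (Sing Omega u `|` Sing Omega v)) = 0%E ->
  forall p, Omega p -> u p <= v p.
Proof.
move=> oOm _ bOm C2u C2v cu cv dN bdry H1S p Op; rewrite -subr_le0.
exact: (comparison oOm bOm C2u C2v cu cv bdry dN H1S Op).
Qed.
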